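(* Consider the sparse stochastic block model $\mathrm{SBM}(n,q,a,b)$ with a growing number of communities, where $q=\omega(1)$, $a=\Theta(q)$ and $b=\Theta(1)$ as $n\to\infty$. If $q=n^{1/2-\Omega(1)}$ and $d\lambda^2\le1$, then $\mathrm{Corr}_{\le n^{\Omega(1)}}\le n^{-\Omega(1)}$; that is, there exist constants $c,c'>0$ such that $\mathrm{Corr}_{\le n^{c}}\le n^{-c'}$ for all sufficiently large $n$.
   Context: Stochastic block model $\mathrm{SBM}(n,q,a,b)$: $q=q_n\ge2$ is an integer, $a=a_n,b=b_n>0$. Each vertex $u\in[n]$ receives a community $\sigma^\star_u\in[q]$ independently and uniformly at random; given $\sigma^\star$, each possible edge $\{u,v\}$ is included independently with probability $a/n$ if $\sigma^\star_u=\sigma^\star_v$ and $b/n$ otherwise. Set $d=\frac{a+(q-1)b}{q}$ and $\lambda=\frac{a-b}{a+(q-1)b}$. The graph is encoded by $Y=(Y_{ij})_{1\le i<j\le n}\in\{0,1\}^{\binom n2}$. The condition $q=n^{1/2-\Omega(1)}$ means $q\le n^{1/2-\varepsilon}$ for some constant $\varepsilon>0$. Let $\mathbb R[Y]_{\le D}$ be the set of real multivariate polynomials of degree at most $D$ in the variables $Y_{ij}$. The degree-$D$ correlation is $$\mathrm{Corr}_{\le D}:=\sup_{f\in\mathbb R[Y]_{\le D}}\frac{\mathbb E[f(Y)\cdot x]}{\sqrt{\mathbb E[f(Y)^2]\cdot\mathbb E[x^2]}},\qquad x:=\mathbf 1\{\sigma^\star_1=\sigma^\star_2\}-\frac1q,$$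 with expectations over the joint law of $(\sigma^\star,Y)$ (and $f$ ranging over polynomials with $\mathbb E[f(Y)^2]\neq0$). *)

(* Defs.v *)
From mathcomp Require Import all_boot all_order all_algebra.
From mathcomp Require Import all_classical all_reals all_analysis.
(* Notations excluded: they clash with those of mathcomp-analysis. *)
From mathcomp Require Import -(notations) mpoly.

Set Implicit Arguments.
Unset Strict Implicit.
Unset Printing Implicit Defensive.

Import Order.TTheory GRing.Theory Num.Theory.
Import numFieldNormedType.Exports.

Local Open Scope ring_scope.
Local Open Scope classical_set_scope.

Definition edge (n : nat) : finType :=
  {e : 'I_n * 'I_n | (e.1 < e.2)%N}.

Definition graph (n : nat) : finType := {ffun edge n -> bool}.

Definition labeling (n q : nat) : finType := {ffun 'I_n -> 'I_q}.

Definition edge_prob (R : realType) (n q : nat) (a b : R)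
    (s : labeling n q) (e : edge n) : R :=
  (if s (val e).1 == s (val e).2 then a else b) / n%:R.

(* Joint mass function of (sigma, Y). It is a probability as soon as
   0 < q and a / n, b / n lie in [0, 1]; no truncation is applied otherwise. *)
Definition sbm_pmf (R : realType) (n q : nat) (a b : R)
    (s : labeling n q) (Y : graph n) : R :=
  q%:R^-1 ^+ n *
  \prod_(e : edge n)
    (if Y e then edge_prob a b s e else 1 - edge_prob a b s e).

Definition sbm_expectation (R : realType) (n q : nat) (a b : R)
    (F : labeling n q -> graph n -> R) : R :=
  \sum_(s : labeling n q) \sum_(Y : graph n) sbm_pmf a b s Y * F s Y.

Definition avg_degree (R : realType) (q : nat) (a b : R) : R :=
  (a + (q%:R - 1) * b) / q%:R.

Definition snr_lambda (R : realType) (q : nat) (a b : R) : R :=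
  (a - b) / (a + (q%:R - 1) * b).

(* The variables Y_ij, i < j, are numbered by the enumeration of [edge n]. *)
Definition edge_poly (R : realType) (n : nat) :=
  mpoly.mpoly #|edge n| R.

(* [mpoly.msize f] is 1 + the degree of f, and 0 for f = 0. *)
Definition edge_poly_deg (R : realType) (n : nat) (f : edge_poly R n) : nat :=
  (mpoly.msize f).-1.

Definition edge_poly_eval (R : realType) (n : nat) (f : edge_poly R n)
    (Y : graph n) : R :=
  mpoly.meval (fun k : 'I_#|edge n| => (Y (enum_val k))%:R) f.

Definition same_community (R : realType) (n q : nat) (u v : 'I_n)
    (s : labeling n q) : R :=
  (s u == s v)%:R - q%:R^-1.

(* The degree bound D is real, so that D = n ^ c needs no rounding; the
   supremum is taken in the extended reals, so it has no default value. *)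
Definition Corr (R : realType) (n q : nat) (a b : R) (u v : 'I_n) (D : R)
    : \bar R :=
  let E := @sbm_expectation R n q a b in
  let x := @same_community R n q u v in
  ereal_sup
    [set (E (fun s Y => edge_poly_eval f Y * x s) /
          Num.sqrt (E (fun _ Y => edge_poly_eval f Y ^+ 2) *
                    E (fun s _ => x s ^+ 2)))%:E
      | f in [set f : edge_poly R n |
               (edge_poly_deg f)%:R <= D /\
               E (fun _ Y => edge_poly_eval f Y ^+ 2) != 0]].

(* Main.v *)
Require Import Defs.
From mathcomp Require Import all_classical all_reals all_analysis.
From mathcomp Require Import -(notations) mpoly.
From mathcomp Require Import all_boot all_order all_algebra.
From mathcomp Require Import algC cyclotomic.
From mathcomp Require Import zify ring lra.

(** The bound comes from a dual certificate: a random variable U(sigma, Y),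
allowed to look at the labels, with E[f(Y) U] = E[f(Y) x] for every polynomial
f of degree at most D. By Cauchy-Schwarz, Corr^2 <= E[U^2] / E[x^2] for any
such U, so one explicit U with a small second moment suffices.

Put p = d / n, k_e = q 1(sigma_i = sigma_j) - 1 and g_e = 1 + lambda k_e for an
edge e = ij. Then e is present with probability p_e = p g_e, and
x = k_uv / q. The variables h_e = (Y_e - p_e) / (1 - p_e) are, given sigma,
independent and centred, with E[h_e Y_e] = p_e and
E[h_e^2] = p_e / (1 - p_e). Take U = sum over |A| <= D of c_A prod_(e in A) h_e
with real coefficients c_A. Tested against the monomial prod_(e in B) Y_e, the
requirement on U becomes

    (sum over A included in B of c_A) Z_B = sum over sigma of g^B x,

where Z_B = sum over sigma of g^B is a Potts partition function: all powers of
p cancel. Replacing g_e by g_e - 1 = lambda k_e on the edges outside A gives an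
equivalent triangular system ([exists_coefficients], [sum_coef]), and the rest
is an estimate of its solution. Here and below g^B stands for the product of
the g_e over B.

Support. If B has a vertex of degree one other than u and v, or a component
avoiding u and v, then averaging over the labels there shows c_B = 0
([coef_core]). The remaining edge sets are called cores. Build a core from
{u, v} edge by edge; its surplus r counts the edges that bring no new vertex,
so a core with m edges has m - r vertices besides u and v.

Size. Every k_e has nonnegative Fourier coefficients on Z/q, so products of such
kernels have nonnegative sums, a Griffiths type inequality ([sum_potts_ge0]).
It allows one to replace k_e by the larger q 1(sigma_i = sigma_j), whose sums
are computed edge by edge: a factor 1 for an edge to a new vertex and at most q
for a surplus edge. A core A contained in a core B is determined by
r(B) - r(A) edges of B ([card_subcores]), so the recursion for c yields

    |c_B| Z_B <= lambda^m q^(r - 1) (2 D)^r q^n        ([coef_bound]),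

and Z_B >= q^n.

Count. A core can be drawn with a moving pen that is lifted O(r) times, so there
are at most n^(m - r) D^(O(r)) of them ([card_cores]). Since E[U^2] is the sum
of the c_A^2 E[prod h_e^2], these bounds give

    E[U^2] <= q^-2 sum over m <= D, r >= 1 of
              (n p lambda^2)^m (q^2 D^(O(1)) / n)^r

up to a constant. The condition d lambda^2 <= 1 says exactly that each edge
costs a factor n p lambda^2 at most 1, even when m is a power of n, and
q = n^(1/2 - Omega(1)) makes the factor of each surplus edge a negative power
of n. As r >= 1 and E[x^2] >= 1 / (2 q), the quotient E[U^2] / E[x^2] is a
negative power of n when D is a small power of n. *)

Set Implicit Arguments.
Unset Strict Implicit.
Unset Printing Implicit Defensive.

Import Order.TTheory GRing.Theory Num.Theory.
Import numFieldNormedType.Exports.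

(** * Edge sets rooted at a vertex set *)

Section RootedEdgeSets.
Variables (V E : finType) (ends : E -> {set V}).
Implicit Types (W U : {set V}) (H A B D Z : {set E}) (e : E) (y : V).

Definition verts W H : {set V} := W :|: \bigcup_(e in H) ends e.

Definition edges_at H y : {set E} := [set e in H | y \in ends e].

(** Every component of [H] meets [W]. Stating this through closed vertex sets
avoids paths: the two uses are to find an edge leaving a given set, and to
split off the edges outside a closed set. *)
Definition attached W H : Prop :=
  forall U, W \subset U ->
    (forall e, e \in H -> ~~ [disjoint ends e & U] -> ends e \subset U) ->
    forall e, e \in H -> ends e \subset U.

Definition leafless W H : Prop :=
  forall y, y \notin W -> #|edges_at H y| != 1.

(** These are the only edge sets on which the certificate has a nonzero
coefficient, see [coef_core]. *)
Definition core W H : Prop := attached W H /\ leafless W H.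

Lemma in_verts W H y :
  (y \in verts W H) = (y \in W) || [exists e in H, y \in ends e].
Proof.
rewrite inE; congr (_ || _); apply/bigcupP/existsP.
  by case=> e eH ye; exists e; rewrite eH.
by case=> e /andP[eH ye]; exists e.
Qed.

Lemma sub_verts W H : W \subset verts W H. Proof. exact: subsetUl. Qed.

Lemma ends_sub_verts W H e : e \in H -> ends e \subset verts W H.
Proof. by move=> eH; apply: subsetU; rewrite (bigcup_sup e) ?orbT. Qed.

Lemma verts0 W : verts W set0 = W.
Proof. by rewrite /verts big_set0 setU0. Qed.

Lemma verts_setU W A B : verts (verts W A) B = verts W (A :|: B).
Proof. by rewrite /verts bigcup_setU setUA. Qed.

Lemma verts_setU1 W H e : verts W (e |: H) = verts W H :|: ends e.
Proof. by rewrite setUC -verts_setU /verts big_set1. Qed.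

Hypothesis card_ends : forall e, #|ends e| = 2.

Lemma ends_neq0 e : ends e != set0.
Proof. by rewrite -card_gt0 card_ends. Qed.

(** Otherwise [W] itself would be closed, hence contain every edge. *)
Lemma attached_touch W H : attached W H -> H != set0 ->
  exists2 e, e \in H & ~~ [disjoint ends e & W].
Proof.
move=> aH /set0Pn[e0 e0H].
have [/existsP[e /andP[eH eW]]|/existsPn nH] :=
  boolP [exists e in H, ~~ [disjoint ends e & W]]; first by exists e.
exists e0 => //; apply/negP => dW.
have sub0 : ends e0 \subset W.
  by apply: (aH W) => // e eH; have := nH e; rewrite eH negbK => ->.
by move: dW; rewrite -setI_eq0 (setIidPl sub0) (negPf (ends_neq0 _)).
Qed.

Lemma attached_setD W H A : attached W H -> A \subset H ->
  attached (verts W A) (H :\: A).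
Proof.
move=> aH AH U WU U_closed e /setDP[eH _].
apply: (aH U) => // [|e' e'H]; first exact: subset_trans (sub_verts _ _) WU.
have [e'A _|e'A] := boolP (e' \in A); last by apply: U_closed; rewrite inE e'A.
exact: subset_trans (ends_sub_verts _ e'A) WU.
Qed.

Lemma attached_setU W H A : attached W A -> attached (verts W A) H ->
  attached W (A :|: H).
Proof.
move=> aA aH U WU U_closed.
have UA e : e \in A -> ends e \subset U.
  by apply: aA => // e' e'A; apply: U_closed; rewrite inE e'A.
have WAU : verts W A \subset U by rewrite subUset WU; apply/bigcupsP.
move=> e; rewrite inE => /orP[/UA //|].
by apply: aH => // e' e'H; apply: U_closed; rewrite inE e'H orbT.
Qed.

Lemma attached0 W : attached W set0.
Proof. by move=> U _ _ e; rewrite inE. Qed.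

Lemma attached1 W e : ~~ [disjoint ends e & W] -> attached W [set e].
Proof.
move=> eW U WU U_closed f /set1P->; apply: U_closed; rewrite ?set11 //.
by apply: contra eW; apply: disjointWr.
Qed.

(** Exploration of an attached edge set from its roots: [e] is explored first,
after which its ends count as roots. All later inductions follow this order. *)
Lemma attached_rect (P : {set V} -> {set E} -> Prop) :
    (forall W, P W set0) ->
    (forall W B e, e \notin B -> ~~ [disjoint ends e & W] ->
       attached (W :|: ends e) B -> P (W :|: ends e) B -> P W (e |: B)) ->
  forall W B, attached W B -> P W B.
Proof.
move=> P0 Pcons W B; move: {2}#|B| (erefl #|B|) => m.
elim: m W B => [|m IH] W B.
  by move/eqP; rewrite cards_eq0 => /eqP-> _.
move=> cB aB; have B0 : B != set0 by rewrite -card_gt0 cB.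
have [e eB eW] := attached_touch aB B0.
have aB' : attached (W :|: ends e) (B :\ e).
  have := attached_setD aB (_ : [set e] \subset B); rewrite sub1set => /(_ eB).
  by rewrite /verts big_set1.
rewrite -(setD1K eB); apply: Pcons => //; first by rewrite !inE eqxx.
by apply: IH => //; apply: succn_inj; rewrite -cB (cardsD1 e B) eB.
Qed.

(** The cyclomatic number of [H] once [W] is contracted to a point. The
subtraction is not truncated for attached sets, see [attached_card]. *)
Definition surplus W H : nat := #|H| + #|W| - #|verts W H|.

Lemma card_setU_ends W e : ~~ [disjoint ends e & W] ->
  #|W :|: ends e| + (ends e \subset W) = #|W|.+1.
Proof.
move=> eW; have [sW|nsW] := boolP (ends e \subset W).
  by rewrite (setUidPl sW) addn1.
rewrite addn0 cardsU card_ends.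
have : 0 < #|W :&: ends e| < 2.
  rewrite card_gt0 setI_eq0 disjoint_sym eW /= -(card_ends e).
  apply: proper_card; rewrite properE subsetIr.
  by apply: contra nsW => sub; apply: subset_trans sub (subsetIl _ _).
by lia.
Qed.

Lemma attached_card W H : attached W H -> #|verts W H| <= #|H| + #|W|.
Proof.
move: W H; apply: attached_rect => [W|W B e eB eW _ IH].
  by rewrite verts0 leq_addl.
rewrite setUC -verts_setU in IH *; move: IH; rewrite setUC.
rewrite cardsU1 eB; have := card_setU_ends eW.
rewrite /verts big_set1 => *; lia.
Qed.

Lemma surplusK W H : attached W H ->
  surplus W H + #|verts W H| = #|H| + #|W|.
Proof. by move=> aH; rewrite subnK // attached_card. Qed.

Lemma surplus0 W : surplus W set0 = 0.
Proof. by rewrite /surplus verts0 cards0 subnn. Qed.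

Lemma surplus_setU W A H : attached W A -> attached (verts W A) H ->
  [disjoint A & H] ->
  surplus W (A :|: H) = surplus W A + surplus (verts W A) H.
Proof.
move=> aA aH dAH; have := surplusK (attached_setU aA aH).
have := surplusK aA; have := surplusK aH.
have -> : #|A :|: H| = #|A| + #|H| by apply/eqP; rewrite -leq_card_setU in dAH *.
by rewrite verts_setU; lia.
Qed.

Lemma surplus1 W e : ~~ [disjoint ends e & W] ->
  surplus W [set e] = (ends e \subset W).
Proof.
move=> eW; have := surplusK (attached1 eW); have := card_setU_ends eW.
by rewrite /verts big_set1 cards1; lia.
Qed.

Lemma surplus_cons W B e : e \notin B -> ~~ [disjoint ends e & W] ->
  attached (W :|: ends e) B ->
  surplus W (e |: B) = (ends e \subset W) + surplus (W :|: ends e) B.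
Proof.
move=> eB eW aB; have vE : verts W [set e] = W :|: ends e by rewrite /verts big_set1.
rewrite surplus_setU ?surplus1 ?vE ?disjoints1 //; exact: attached1.
Qed.

(** Take for [Z] the explored edges that reach no new vertex. The other edges
form a forest hanging from [W], and in each nonempty part of a forest the
vertex explored last is a leaf. *)
Lemma feedback_edges W B : attached W B -> exists Z : {set E},
  [/\ Z \subset B, #|Z| = surplus W B &
      forall D, D \subset B :\: Z -> D != set0 ->
        exists2 y, y \notin W & #|edges_at D y| = 1].
Proof.
move: W B; apply: attached_rect => [W|W B e eB eW aB [Z [ZB cZ leafZ]]].
  exists set0; rewrite sub0set cards0 surplus0; split=> // D.
  by rewrite setD0 subset0 => /eqP->; rewrite eqxx.
have eZ : e \notin Z by apply: contra eB; apply: (subsetP ZB).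
have leaf_up D : D :\ e \subset B :\: Z -> D :\ e != set0 ->
    exists2 y, y \notin W & #|edges_at D y| = 1.
  move=> sD /(leafZ _ sD)[y]; rewrite inE negb_or => /andP[yW ye] <-.
  exists y => //; apply: eq_card => f; rewrite !inE.
  by case: (f =P e) => [->|]; rewrite ?(negPf ye) ?andbF.
rewrite surplus_cons //; have [sW|nsW] := boolP (ends e \subset W).
  exists (e |: Z); split=> [||D sD D0]; first exact: setUS.
    by rewrite cardsU1 eZ cZ.
  have De : D :\ e = D.
    apply/setDidPl; rewrite disjoint_sym disjoints1; apply/negP => /(subsetP sD).
    by rewrite !inE eqxx.
  apply: leaf_up; rewrite De //; apply/subsetP=> f /[dup] fD /(subsetP sD).
  by rewrite !inE => /andP[/norP[/negPf-> ->]].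
exists Z; split=> [||D sD D0]; rewrite ?cZ ?add0n //.
  exact: subset_trans ZB (subsetUr _ _).
have [De0|De] := eqVneq (D :\ e) set0; last first.
  apply: leaf_up => //; apply/subsetP=> f /setD1P[fe /(subsetP sD)].
  by rewrite !inE (negPf fe).
have DE : D = [set e].
  by apply/eqP; rewrite eqEsubset sub1set -setD_eq0 De0 eqxx;
     move: D0; apply: contraNT => eD; rewrite -De0; apply/eqP/esym/setDidPl;
     rewrite disjoint_sym disjoints1.
have /subsetPn[y ye yW] := nsW.
exists y => //; rewrite -(cards1 e); apply: eq_card => f.
by rewrite DE !inE; case: (f =P e) => [->|].
Qed.


(** Once the feedback edges of [H] relative to [A] are deleted, what remains
outside [A] is a forest, which a leafless set cannot use. Hence [A] is the
largest core avoiding [Z], and [Z] determines it. *)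
Lemma core_gap W A H : core W A -> core W H -> A \subset H ->
  exists Z : {set E},
    [/\ Z \subset H, [disjoint A & Z], #|Z| + surplus W A = surplus W H &
        forall D, core W D -> D \subset H :\: Z -> D \subset A].
Proof.
move=> [aA lA] [aH lH] AH; have aB := attached_setD aH AH.
have dAB : [disjoint A & H :\: A].
  by rewrite -setI_eq0 setIDA setIC -setIDA setDv setI0.
have HE : A :|: (H :\: A) = H.
  by apply/setP => f; rewrite !inE; have [/(subsetP AH)->|] := boolP (f \in A).
have [Z [ZB cZ leafZ]] := feedback_edges aB; exists Z; split.
- exact: subset_trans ZB (subsetDl _ _).
- exact: disjointWr ZB dAB.
- by rewrite cZ addnC -surplus_setU ?HE.
move=> D [aD lD] DH; rewrite -setD_eq0; apply/negPn/negP => D0.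
have [|y yWA leaf] := leafZ (D :\: A) _ D0.
  by apply/subsetP => f /setDP[/(subsetP DH)]; rewrite !inE => /andP[-> ->] ->.
have yW : y \notin W by apply: contra yWA; apply/subsetP/sub_verts.
have := lD y yW; rewrite -leaf => /eqP; apply; apply: eq_card => f.
rewrite !inE; have [fA|//] := boolP (f \in A).
suff /negPf-> : y \notin ends f by rewrite !andbF.
by apply: contra yWA; apply/subsetP/ends_sub_verts.
Qed.

Lemma core_surplus_lt W A H : core W A -> core W H -> A \proper H ->
  surplus W A < surplus W H.
Proof.
move=> cA cH /properP[AH [e eH eA]].
have [Z [ZH _ <- maxA]] := core_gap cA cH AH.
rewrite -{1}[surplus W A]add0n ltn_add2r card_gt0; apply: contraNneq eA => Z0.
by apply: (subsetP (maxA H cH _)) => //; rewrite Z0 setD0.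
Qed.

(** By [core_gap] a core inside [H] is encoded by as many edges of [H] as it
has surplus less than [H]. *)
Lemma card_subcores W H (F : {set {set E}}) j : core W H ->
    (forall A, A \in F -> [/\ core W A, A \subset H & surplus W A = j]) ->
  #|F| <= #|H| ^ (surplus W H - j).
Proof.
move=> cH FP; set s := _ - j.
pose good A Z := [/\ Z \subset H, [disjoint A & Z], #|Z| = s &
  forall D, core W D -> D \subset H :\: Z -> D \subset A].
have ex_good A : exists Z, A \in F -> good A Z.
  have [/FP[cA AH sA]|] := boolP (A \in F); last by exists set0.
  have [Z [? ? cZ ?]] := core_gap cA cH AH; exists Z => _; split=> //.
  by rewrite /s -cZ sA addnK.
have [Zf ZfP] := fin_all_exists ex_good.
have Zf_inj : {in F &, injective Zf}.
  have sub A B : A \in F -> B \in F -> Zf A = Zf B -> A \subset B.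
    move=> AF BF ZE; have [cA AH _] := FP _ AF; have [_ _ _] := ZfP _ BF; apply=> //.
    by rewrite -ZE subsetD AH; have [] := ZfP _ AF.
  by move=> A B AF BF ZE; apply/eqP; rewrite eqEsubset !sub.
rewrite -(card_in_imset Zf_inj).
apply: leq_trans (_ : 'C(#|H|, s) <= _).
  rewrite -cards_draws; apply: subset_leq_card; apply/subsetP => _ /imsetP[A AF ->].
  by rewrite inE; have [-> _ ->] := ZfP _ AF; rewrite eqxx.
apply: leq_trans (_ : #|H| ^_ s <= _).
  by rewrite -bin_ffact leq_pmulr ?fact_gt0.
elim: s {good ex_good Zf ZfP Zf_inj} => // s IH.
by rewrite ffactnSr expnSr leq_mul ?leq_subr.
Qed.


Lemma sum_by_value (F : {set {set E}}) (val : {set E} -> nat) (f : nat -> nat) N :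
  {in F, forall A, val A < N} ->
  \sum_(A in F) f (val A) = \sum_(j < N) #|[set A in F | val A == j]| * f j.
Proof.
move=> valN; rewrite (eq_bigr (fun A => \sum_(j < N) (val A == j) * f j)).
  rewrite exchange_big /=; apply: eq_bigr => j _.
  rewrite -big_distrl /= -big_mkcondr /= -sum1_card; congr (_ * _).
  by apply: eq_bigl => A; rewrite inE.
move=> A /valN vN; rewrite (bigD1 (Ordinal vN)) //= eqxx mul1n big1 ?addn0 // => j.
by rewrite -val_eqE /= eq_sym => /negPf->.
Qed.

(** This closes the recursion for the coefficients: the number of subcores of
surplus [j] is compensated by the ratio of the weights (2M)^j and (2M)^r, which
leaves a geometric series of ratio 2. *)
Lemma sum_subcores W H (F : {set {set E}}) M :
    core W H -> #|H| <= M -> 0 < M ->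
    (forall A, A \in F -> core W A /\ A \proper H) ->
  (\sum_(A in F) (2 * M) ^ surplus W A).+1 <= (2 * M) ^ surplus W H.
Proof.
move=> cH HM M0 FP; rewrite (@sum_by_value F (surplus W) _ (surplus W H)); last first.
  by move=> A /FP[cA AH]; apply: core_surplus_lt.
(* Subcores of surplus j number at most M^(r - j) and weigh (2M)^j each. *)
apply: (@leq_trans (\sum_(j < surplus W H) M ^ surplus W H * 2 ^ j).+1).
  rewrite ltnS; apply: leq_sum => j _; rewrite expnMn mulnCA mulnC leq_mul2r.
  have MsE : M ^ surplus W H = M ^ (surplus W H - j) * M ^ j.
    by rewrite -expnD subnK // ltnW.
  apply/orP; right; rewrite MsE leq_mul2r.
  apply/orP; right; apply: (@leq_trans (#|H| ^ (surplus W H - j))).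
    by apply: card_subcores => // A; rewrite inE => /andP[/FP[? /proper_sub ?] /eqP].
  by elim: (_ - _) => // k IH; rewrite !expnS leq_mul.
rewrite -big_distrr /= expnMn.
have : (\sum_(j < surplus W H) 2 ^ j).+1 = 2 ^ surplus W H.
  by elim: (surplus W H) => [|k IH]; rewrite ?big_ord0 // big_ord_recr /= -addSn IH expnS mul2n addnn.
have : 0 < M ^ surplus W H by rewrite expn_gt0 M0.
by move=> Ms <-; rewrite mulSn mulnC -add1n leq_add2r.
Qed.

(** States of a drawing process: the first list holds finished edge sets, the
second list holds edge sets with a pen at a vertex that may be a leaf. On a
finished set the pen may be put down at any vertex. *)
Definition tips W (L : seq {set E} * seq ({set E} * V)) : seq ({set E} * V) :=
  L.2 ++ flatten [seq [seq (H, t) | t <- enum (verts W H)] | H <- L.1].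

(** The pen moves to a vertex that is already present: few choices, and one
more unit of surplus. *)
Definition closings W (x : {set E} * V) : seq {set E} :=
  [seq e |: x.1 | e <- enum [set e | x.2 \in ends e & ends e \subset verts W x.1]].

(** The pen moves to a new vertex: about as many choices as there are vertices.
The surplus does not change. *)
Definition extensions (x : {set E} * V) : seq ({set E} * V) :=
  [seq (p.1 |: x.1, p.2) |
     p <- enum [set p : E * V | x.2 != p.2 & ends p.1 == [set x.2; p.2]]].

(** The states reached after [m] moves, [r] of which are closings. Repetitions and
edge sets that are not cores occur too: only an upper bound on the number of
cores is needed, for which [core_built] is enough. *)
Fixpoint builds W m r : seq {set E} * seq ({set E} * V) :=
  if m is m'.+1 then
    (if r is r'.+1 then flatten (map (closings W) (tips W (builds W m' r')))
     else [::],
     flatten (map extensions (tips W (builds W m' r))))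
  else (if r == 0 then [:: set0] else [::], [::]).

Lemma card_verts W H : #|verts W H| <= #|W| + 2 * #|H|.
Proof.
apply: leq_trans (leq_card_setU _ _) _; rewrite leq_add2l.
rewrite mulnC -sum_nat_const.
apply: (big_rec2 (fun (A : {set V}) k => #|A| <= k)) => [|e k A _ Ak].
  by rewrite cards0.
by apply: leq_trans (leq_card_setU _ _) _; rewrite card_ends leq_add2l.
Qed.

Hypothesis ends_inj : injective ends.

Lemma card_closing_edges U t :
  #|[set e | t \in ends e & ends e \subset U]| <= #|U|.
Proof.
pose A := [set e | t \in ends e & ends e \subset U].
have other e : e \in A -> exists2 y, y \in U & ends e = [set t; y].
  rewrite inE => /andP[te eU].
  have /eqP := card_ends e; rewrite (cardsD1 t) te eqSS => /cards1P[y yE].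
  exists y; last by rewrite -yE setD1K.
  by apply: (subsetP eU); have /setD1P[] : y \in ends e :\ t by rewrite yE set11.
have ex_other e : exists y, e \in A -> y \in U /\ ends e = [set t; y].
  have [/other[y yU yE]|_] := boolP (e \in A); last by exists t.
  by exists y.
have [f fP] := fin_all_exists ex_other.
rewrite -/A -(card_in_imset (_ : {in A &, injective f})).
  by apply: subset_leq_card; apply/subsetP=> _ /imsetP[e /fP[fU _] ->].
move=> e e' /fP[_ eE] /fP[_ e'E] fE; apply: ends_inj.
by rewrite eE e'E fE.
Qed.

Lemma card_extension_edges t :
  #|[set p : E * V | t != p.2 & ends p.1 == [set t; p.2]]| <= #|V|.
Proof.
rewrite -cardsT -(card_in_imset (_ : {in _ &, injective snd})).
  exact/subset_leq_card/subsetT.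
move=> [e y] [e' y'] /[!inE]/= /andP[_ /eqP eE] /andP[_ /eqP e'E] yE.
by congr pair => //; apply: ends_inj; rewrite eE e'E yE.
Qed.

Lemma size_flatten_map_leq (S T : eqType) (f : S -> seq T) (s : seq S) k :
  {in s, forall x, size (f x) <= k} -> size (flatten (map f s)) <= size s * k.
Proof.
elim: s => [|x s IH] //= fk; rewrite size_cat mulSn leq_add ?fk ?mem_head //.
by apply: IH => y ys; apply: fk; rewrite inE ys orbT.
Qed.

Lemma builds_card W m r :
  (forall H, H \in (builds W m r).1 -> #|H| <= m) /\
  (forall x, x \in (builds W m r).2 -> #|x.1| <= m).
Proof.
elim: m r => [|m IH] r /=.
  by split=> // H; case: eqP => // _; rewrite inE => /eqP->; rewrite cards0.
have tips_card r' x : x \in tips W (builds W m r') -> #|x.1| <= m.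
  have [cH cx] := IH r'; rewrite mem_cat => /orP[/cx//|].
  by case/flatten_mapP=> H /cH Hm /mapP[t _ ->].
have addm e H : #|H| <= m -> #|e |: H| <= m.+1.
  by move=> Hm; rewrite cardsU1 (leq_add (leq_b1 _) Hm).
split.
  case: r => // r H /flatten_mapP[x xt /mapP[e _ ->]].
  exact/addm/(tips_card _ _ xt).
move=> z /flatten_mapP[x xt /mapP[e _ ->]] /=.
exact/addm/(tips_card _ _ xt).
Qed.

Let close_arith a b n K m M Vm Vr Xr : a <= b * K ->
  b * Vr <= K * m.+1 * Vm * Xr -> m < M ->
  a * (n * Vr) <= n * Vm * (K ^ 2 * M.+1 * Xr).
Proof.
move=> aK ba mM; apply: leq_trans (leq_mul aK (leqnn _)) _.
rewrite (_ : b * K * _ = b * Vr * (K * n)); last by lia.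
apply: leq_trans (leq_mul ba (leqnn _)) _.
rewrite (_ : _ * (K * n) = (K * K * n * Vm * Xr) * m.+1); last by lia.
rewrite (_ : n * Vm * _ = (K * K * n * Vm * Xr) * M.+1); last by lia.
by rewrite leq_mul2l leqW ?orbT.
Qed.

Let extend_arith a b n K m Vm Vr Xr : a <= b * n ->
  b * Vr <= K * m.+1 * Vm * Xr -> a * Vr <= K * m.+1 * (n * Vm) * Xr.
Proof.
move=> ab bV; apply: leq_trans (leq_mul ab (leqnn _)) _.
rewrite mulnAC (_ : K * _ * _ * _ = K * m.+1 * Vm * Xr * n) ?leq_mul2r ?bV ?orbT //.
by lia.
Qed.

(** Each of the [m] edges costs a factor #|V|, except that the [r] closing edges
cost X / #|V| more, where X pays for the end of the closing edge, for the place
where the pen is put down, and for the moment of doing so. *)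
Lemma size_builds W M m r (K := #|W| + 2 * M) (X := K ^ 2 * M.+1) : m <= M ->
  size (builds W m r).1 * #|V| ^ r <= #|V| ^ m * X ^ r /\
  size (builds W m r).2 * #|V| ^ r <= K * m * #|V| ^ m * X ^ r.
Proof.
elim: m r => [|m IH] r mM.
  by rewrite muln0 /=; case: eqP => [->|_]; rewrite ?mul0n.
have vK H : #|H| <= m -> #|verts W H| <= K.
  move=> Hm; apply: leq_trans (card_verts _ _) _.
  by rewrite leq_add2l leq_mul2l (leq_trans Hm) // ltnW.
have tips_card r' x : x \in tips W (builds W m r') -> #|verts W x.1| <= K.
  have [cH cx] := builds_card W m r'.
  rewrite mem_cat => /orP[/cx/vK//|].
  by case/flatten_mapP=> H /cH/vK ? /mapP[t _ ->].
have size_tips r' : size (tips W (builds W m r')) * #|V| ^ r' <=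
    K * m.+1 * #|V| ^ m * X ^ r'.
  have [IH1 IH2] := IH r' (ltnW mM).
  have : size (tips W (builds W m r')) <=
      size (builds W m r').2 + size (builds W m r').1 * K.
    rewrite size_cat leq_add2l; apply: size_flatten_map_leq => H HL.
    by rewrite size_map -cardE vK //; have [cH _] := builds_card W m r'; apply: cH.
  move=> sz; apply: leq_trans (leq_mul sz (leqnn _)) _.
  rewrite (_ : K * m.+1 * _ * _ = K * (#|V| ^ m * X ^ r') + K * m * #|V| ^ m * X ^ r').
    by rewrite addnC mulnDl mulnAC mulnC leq_add // leq_mul.
  by rewrite mulnS !mulnDl !mulnA.
split.
  case: r => [|r] /=; first by rewrite mul0n.
  have : size (flatten (map (closings W) (tips W (builds W m r)))) <=
      size (tips W (builds W m r)) * K.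
    apply: size_flatten_map_leq => x /tips_card xK.
    by rewrite size_map -cardE (leq_trans (card_closing_edges _ _)).
  move=> sz; rewrite !(expnS #|V|) (expnS X).
  exact: close_arith sz (size_tips r) mM.
have : size (flatten (map extensions (tips W (builds W m r)))) <=
    size (tips W (builds W m r)) * #|V|.
  apply: size_flatten_map_leq => x _.
  by rewrite size_map -cardE card_extension_edges.
by move=> sz; rewrite expnS; apply: extend_arith sz (size_tips r).
Qed.

Lemma core0 W : core W set0.
Proof.
split=> [|y _]; first exact: attached0.
rewrite (_ : edges_at _ _ = set0) ?cards0 //.
by apply/setP=> e; rewrite !inE.
Qed.

Lemma edges_atU1 H e y : e \notin H ->
  #|edges_at (e |: H) y| = (y \in ends e) + #|edges_at H y|.
Proof.
move=> eH; have [ye|ye] := boolP (y \in ends e); last first.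
  apply: eq_card => f; rewrite !inE.
  by case: (f =P e) => [->|//]; rewrite (negPf ye) !andbF.
rewrite (_ : edges_at (e |: H) y = e |: edges_at H y).
  by rewrite cardsU1 !inE (negPf eH).
by apply/setP=> f; rewrite !inE; case: (f =P e) => [->|].
Qed.

Lemma edges_at_gt0 W H y : y \in verts W H -> y \notin W -> 0 < #|edges_at H y|.
Proof.
rewrite in_verts => /orP[->//|/existsP[e /andP[eH ye]] _].
by apply/card_gt0P; exists e; rewrite inE eH.
Qed.

(** The drawing of [B] never gets stuck. At a new vertex the pen can go on since
that vertex is not a leaf of [B]; after a closing edge the current set is a core
again, and if it is not all of [B], then an edge of [B] leaves one of its
vertices because [B] is attached. *)
Lemma reach_core W B H t : core W B -> H \subset B -> attached W H ->
    t \in verts W H ->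
    (forall y, y \notin W -> y != t -> #|edges_at H y| != 1) ->
    (exists2 e, e \in B :\: H & t \in ends e) ->
    (H, t) \in tips W (builds W #|H| (surplus W H)) ->
  B \in (builds W #|B| (surplus W B)).1.
Proof.
move=> [aB lB]; move: {2}#|_ :\: _|.+1 (ltnSn #|B :\: H|) => k.
elim: k H t => // k IH H t; rewrite ltnS => Hk HB aH tH lH [e /setDP[eB eH] te] Htips.
have tW : ~~ [disjoint ends e & verts W H].
  by rewrite -setI_eq0; apply/set0Pn; exists t; rewrite inE te.
have eHB : e |: H \subset B by rewrite subUset sub1set eB.
have eHk : #|B :\: (e |: H)| < k.
  apply: leq_trans Hk; apply: proper_card; apply/properP; split.
    by apply: setDS; apply: subsetUr.
  by exists e; rewrite !inE ?eqxx // eH.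
have aeH : attached W (e |: H).
  by rewrite setUC; apply: attached_setU => //; apply: attached1.
have seH : surplus W (e |: H) = (ends e \subset verts W H) + surplus W H.
  rewrite setUC surplus_setU ?surplus1 1?addnC //; first exact: attached1.
  by rewrite disjoint_sym disjoints1.
have ceH : #|e |: H| = #|H|.+1 by rewrite cardsU1 eH.
have deg z : z \in ends e -> z \in verts W H -> z \notin W ->
    #|edges_at (e |: H) z| != 1.
  move=> ze zH zW; rewrite edges_atU1 // ze.
  by have := edges_at_gt0 zH zW; case: #|_|.
have [sub|nsub] := boolP (ends e \subset verts W H).
  have leH y : y \notin W -> #|edges_at (e |: H) y| != 1.
    move=> yW; have [ye|ye] := boolP (y \in ends e).
      by apply: deg => //; apply: (subsetP sub).
    rewrite edges_atU1 // (negPf ye) lH //.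
    by apply: contraNneq ye => ->.
  have eHL : e |: H \in (builds W #|e |: H| (surplus W (e |: H))).1.
    rewrite ceH seH sub /=; apply/flatten_mapP; exists (H, t) => //.
    by apply/mapP; exists e => //; rewrite mem_enum inE te.
  have [<-//|neq] := eqVneq (e |: H) B.
  have BeH0 : B :\: (e |: H) != set0.
    by rewrite setD_eq0; apply: contra neq => BH; rewrite eqEsubset eHB.
  have [e' e'B] := attached_touch (attached_setD aB eHB) BeH0.
  rewrite -setI_eq0 => /set0Pn[t' /setIP[t'e' t'H]].
  apply: (IH (e |: H) t') => //.
  - by move=> y yW _; apply: leH.
  - by exists e'.
  rewrite mem_cat; apply/orP; right; apply/flatten_mapP; exists (e |: H) => //.
  by apply/mapP; exists t' => //; rewrite mem_enum.
have /subsetPn[y ye yH] := nsub.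
have ty : t != y by apply: contraNneq yH => <-.
have yW : y \notin W by apply: contra yH; apply/subsetP/sub_verts.
have eE : ends e = [set t; y].
  apply/esym/eqP; rewrite eqEcard card_ends cards2 ty andbT.
  by rewrite subUset !sub1set te ye.
apply: (IH (e |: H) y) => //.
- by rewrite verts_setU1 inE ye orbT.
- move=> z zW zy; have [ze|ze] := boolP (z \in ends e).
    apply: deg => //; have := ze.
    by rewrite eE => /set2P[->//|zE]; rewrite zE eqxx in zy.
  rewrite edges_atU1 // (negPf ze) lH //.
  by apply: contraNneq ze => ->.
- have : 1 < #|edges_at B y|.
    rewrite ltn_neqAle eq_sym lB //; apply/card_gt0P; exists e.
    by rewrite inE eB.
  rewrite (cardsD1 e) !inE eB ye ltnS => /card_gt0P[e'].
  rewrite !inE => /and3P[e'e e'B ye']; exists e' => //.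
  rewrite !inE (negPf e'e) e'B andbT; apply: contra yH => e'H.
  by apply: (subsetP (ends_sub_verts _ e'H)).
rewrite mem_cat ceH seH (negPf nsub) add0n /=; apply/orP; left.
apply/flatten_mapP; exists (H, t) => //; apply/mapP; exists (e, y) => //.
by rewrite mem_enum inE /= ty eE eqxx.
Qed.

Lemma core_built W B : core W B -> B \in (builds W #|B| (surplus W B)).1.
Proof.
move=> cB; have [->|B0] := eqVneq B set0.
  by rewrite cards0 surplus0 inE.
have [e eB] := attached_touch cB.1 B0.
rewrite -setI_eq0 => /set0Pn[t /setIP[te tW]].
apply: (@reach_core W B set0 t) => //; first exact: sub0set.
- exact: attached0.
- by rewrite verts0.
- by move=> y yW _; apply: (core0 W).2.
- by exists e; rewrite // setD0.
rewrite cards0 surplus0 /= mem_cat; apply/orP; right.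
apply/flatten_mapP; exists set0; first by rewrite inE.
by apply/mapP; exists t => //; rewrite mem_enum verts0.
Qed.

Lemma card_cores W M m r (F : {set {set E}})
    (K := #|W| + 2 * M) (X := K ^ 2 * M.+1) : m <= M ->
    (forall A, A \in F -> [/\ core W A, #|A| = m & surplus W A = r]) ->
  #|F| * #|V| ^ r <= #|V| ^ m * X ^ r.
Proof.
move=> mM FP; apply: leq_trans (size_builds W r mM).1.
rewrite leq_mul2r cardE uniq_leq_size ?enum_uniq ?orbT // => A.
by rewrite mem_enum => /FP[/core_built + cA sA]; rewrite cA sA.
Qed.

End RootedEdgeSets.

(** * Potts kernels and positivity *)

Local Open Scope ring_scope.

Section Characters.
Variables (V : finType) (q : nat).
Hypothesis q_gt0 : (0 < q)%N.
Implicit Types (s : {ffun V -> 'I_q}) (l : seq (V * V)).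

Lemma sum_unity_powers (z : algC) : z ^+ q = 1 ->
  \sum_(0 <= m < q) z ^+ m = if z == 1 then q%:R else 0.
Proof.
move=> zq; have [->|z1] := eqVneq z 1.
  rewrite (eq_bigr (fun=> 1)); first by rewrite sumr_const_nat subn0.
  by move=> i _; rewrite expr1n.
have /eqP := subrX1 z q; rewrite zq subrr eq_sym mulf_eq0 subr_eq0 (negPf z1).
by rewrite big_mkord => /eqP.
Qed.

(** The Fourier expansion on Z/q of the kernel q 1(a = b) - 1: all nontrivial
characters occur, with coefficient 1. *)
Lemma potts_kernel_characters (w : algC) (a b : 'I_q) : q.-primitive_root w ->
  q%:R * (a == b)%:R - 1 =
    \sum_(1 <= m < q) w ^+ (a * m) * w ^+ (b * (q - m)).
Proof.
move=> w_prim; have wq := prim_expr_order w_prim.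
have w0 : w != 0.
  by apply: contra_eq_neq wq => ->; rewrite expr0n gtn_eqF // eq_sym oner_neq0.
pose z := w ^+ a / w ^+ b.
have zq : z ^+ q = 1.
  by rewrite expr_div_n -!exprM ![(_ * q)%N]mulnC !exprM wq !expr1n divr1.
have z1 : (z == 1) = (a == b).
  rewrite /z -[1](divff (expf_neq0 b w0)).
  rewrite (inj_eq (mulIf (invr_neq0 (expf_neq0 b w0)))).
  by rewrite (eq_prim_root_expr w_prim) !modn_small.
have := sum_unity_powers zq; rewrite z1 big_ltn // expr0.
rewrite (_ : q%:R * (a == b)%:R = if a == b then q%:R else 0); last first.
  by case: (a == b); rewrite ?mulr1 ?mulr0.
move=> <-; rewrite addrC addKr; apply: eq_big_nat => m /andP[_ mq].
rewrite expr_div_n -!exprM mulnBr exprB //; last first.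
- by rewrite unitfE.
- by rewrite leq_mul2l ltnW ?orbT.
by rewrite (mulnC b q) (exprM w q) wq expr1n div1r.
Qed.

(** Expanding one kernel only changes the exponents of the character, and the
sum of a character over all configurations is 0 or positive. *)
Lemma sum_potts_characters_ge0 (w : algC) l (c : V -> nat) :
  q.-primitive_root w ->
  0 <= \sum_(s : {ffun V -> 'I_q}) (\prod_(p <- l) (q%:R * (s p.1 == s p.2)%:R - 1)) *
              \prod_i w ^+ (s i * c i).
Proof.
move=> w_prim; have wq := prim_expr_order w_prim.
elim: l c => [|[i j] l IH] c.
  under eq_bigr do rewrite big_nil mul1r.
  rewrite -(bigA_distr_bigA (fun i (k : 'I_q) => w ^+ (k * c i))) /=.
  apply: prodr_ge0 => i _.
  rewrite (eq_bigr (fun k : 'I_q => (w ^+ c i) ^+ k)); last first.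
    by move=> k _; rewrite -exprM mulnC.
  rewrite -(big_mkord xpredT (fun k => (w ^+ c i) ^+ k)) sum_unity_powers.
    by case: ifP.
  by rewrite -exprM mulnC exprM wq expr1n.
have shift s m i' (cc : V -> nat) : w ^+ (s i' * m) * \prod_k w ^+ (s k * cc k) =
    \prod_k w ^+ (s k * (cc k + (k == i') * m)).
  rewrite (bigD1 i') //= [RHS](bigD1 i') //= eqxx mul1n mulnDr exprD mulrCA !mulrA.
  congr (_ * _); apply: eq_bigr => k /negPf->.
  by rewrite mul0n addn0.
under eq_bigr => s _ do
  rewrite big_cons /= (potts_kernel_characters _ _ w_prim) -mulrA mulr_suml.
rewrite exchange_big /=; apply: sumr_ge0 => m _.
under eq_bigr => s _ do rewrite mulrCA -mulrA shift shift.
exact: IH.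
Qed.

(** The sum is an integer, so its sign can be read off in the algebraic complex
numbers. *)
Lemma sum_potts_ge0 (R : realFieldType) l :
  0 <= \sum_(s : {ffun V -> 'I_q}) \prod_(p <- l) (q%:R * (s p.1 == s p.2)%:R - 1) :> R.
Proof.
pose z : int := \sum_(s : {ffun V -> 'I_q}) \prod_(p <- l) (q%:R * (s p.1 == s p.2)%:R - 1).
have zE (T : pzRingType) :
    \sum_(s : {ffun V -> 'I_q}) \prod_(p <- l) (q%:R * (s p.1 == s p.2)%:R - 1) = z%:~R :> T.
  rewrite /z rmorph_sum; apply: eq_bigr => s _.
  rewrite rmorph_prod; apply: eq_bigr => p _.
  by rewrite rmorphB rmorphM !rmorph_nat.
rewrite zE ler0z -(ler0z algC) -zE.
have [w w_prim] := C_prim_root_exists q_gt0.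
have := sum_potts_characters_ge0 l (fun=> 0%N) w_prim.
congr (0 <= _); apply: eq_bigr => s _.
by rewrite [X in _ * X]big1 ?mulr1 // => i _; rewrite muln0.
Qed.

End Characters.

Section PottsCone.
Variables (R : realFieldType) (V : finType) (q : nat).
Hypothesis q_gt0 : (0 < q)%N.
Local Notation config := {ffun V -> 'I_q}.
Implicit Types (s : config) (F G : config -> R) (i j : V) (U W : {set V}).

Definition agree i j s : R := q%:R * (s i == s j)%:R.
Definition potts i j s : R := agree i j s - 1.

(** The sums against all products of kernels are required to be nonnegative, not
only the sum of [F], to get a cone that is stable under multiplication by
kernels. *)
Definition potts_nonneg F : Prop := forall l : seq (V * V),
  0 <= \sum_(s : config) F s * \prod_(p <- l) potts p.1 p.2 s.

(** The multipliers of the cone above: they form a semiring containing the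
nonnegative constants and the kernels. *)
Definition positive F : Prop :=
  forall G, potts_nonneg G -> potts_nonneg (fun s => F s * G s).

Lemma potts_nonneg_ext F G : F =1 G -> potts_nonneg F -> potts_nonneg G.
Proof. by move=> FG Fp l; under eq_bigr do rewrite -FG. Qed.

Lemma positive_ext F G : F =1 G -> positive F -> positive G.
Proof.
by move=> FG Fp H /Fp; apply: potts_nonneg_ext => s; rewrite FG.
Qed.

Lemma positive_sum_ge0 F : positive F -> 0 <= \sum_(s : config) F s.
Proof.
have nn1 : potts_nonneg (fun=> 1).
  by move=> l; under eq_bigr do rewrite mul1r; apply: sum_potts_ge0.
move=> /(_ _ nn1 [::]); congr (0 <= _); apply: eq_bigr => s _.
by rewrite big_nil !mulr1.
Qed.

Lemma positiveC c : 0 <= c -> positive (fun=> c).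
Proof.
move=> c0 G nG l; under eq_bigr do rewrite -mulrA.
by rewrite -mulr_sumr mulr_ge0.
Qed.

Lemma positive_potts i j : positive (potts i j).
Proof.
move=> G nG l; have := nG ((i, j) :: l); congr (0 <= _); apply: eq_bigr => s _.
by rewrite big_cons mulrCA mulrA.
Qed.

Lemma positiveD F G : positive F -> positive G -> positive (fun s => F s + G s).
Proof.
move=> pF pG H nH l; under eq_bigr do rewrite !mulrDl.
by rewrite big_split addr_ge0 ?pF ?pG.
Qed.

Lemma positiveM F G : positive F -> positive G -> positive (fun s => F s * G s).
Proof.
by move=> pF pG H /pG/pF; apply: potts_nonneg_ext => s; rewrite mulrA.
Qed.

Definition dominated F G : Prop := positive (fun s => G s - F s).

Lemma dominated_sum_le F G : dominated F G ->
  \sum_(s : config) F s <= \sum_(s : config) G s.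
Proof. by move=> /positive_sum_ge0; rewrite sumrB subr_ge0. Qed.

Lemma positive_prod (I : finType) (A : {set I}) (F : I -> config -> R) :
  (forall e, positive (F e)) -> positive (fun s => \prod_(e in A) F e s).
Proof.
move=> pF; elim: (index_enum I) => [|e r IH].
  by apply: positive_ext (positiveC ler01) => s; rewrite big_nil.
case eA: (e \in A).
  by apply: positive_ext (positiveM (pF e) IH) => s; rewrite big_cons eA.
by apply: positive_ext IH => s; rewrite big_cons eA.
Qed.

(** Change the factors one at a time; each difference is a product of positive
functions. *)
Lemma dominated_prod (I : finType) (A : {set I}) (F G : I -> config -> R) :
    (forall e, positive (F e)) -> (forall e, dominated (F e) (G e)) ->
  dominated (fun s => \prod_(e in A) F e s) (fun s => \prod_(e in A) G e s).
Proof.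
move=> pF dFG; have pG e : positive (G e).
  by apply: positive_ext (positiveD (pF e) (dFG e)) => s; rewrite addrC subrK.
suff [] : dominated (fun s => \prod_(e in A) F e s) (fun s => \prod_(e in A) G e s)
   /\ positive (fun s => \prod_(e in A) F e s) by [].
elim: (index_enum I) => [|e r [IH pFr]].
  split; last by apply: positive_ext (positiveC ler01) => s; rewrite big_nil.
  by apply: positive_ext (positiveC (lexx 0)) => s; rewrite !big_nil subrr.
case eA: (e \in A).
  split; last by apply: positive_ext (positiveM (pF e) pFr) => s; rewrite big_cons eA.
  apply: positive_ext (positiveD (positiveM (pG e) IH) (positiveM (dFG e) pFr)) => s.
  by rewrite !big_cons eA; ring.
split; last by apply: positive_ext pFr => s; rewrite big_cons eA.
by apply: positive_ext IH => s; rewrite !big_cons eA.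
Qed.

Lemma dominatedM F F' G G' : positive F -> positive F' ->
  dominated F G -> dominated F' G' ->
  dominated (fun s => F s * F' s) (fun s => G s * G' s).
Proof.
move=> pF pF' dFG dFG'.
have pG : positive G.
  by apply: positive_ext (positiveD pF dFG) => s; rewrite addrC subrK.
apply: positive_ext (positiveD (positiveM pG dFG') (positiveM dFG pF')) => s.
by ring.
Qed.

Lemma dominated_refl F : dominated F F.
Proof. by apply: positive_ext (positiveC (lexx 0)) => s; rewrite subrr. Qed.

Lemma dominated_potts_agree i j : dominated (potts i j) (agree i j).
Proof.
by apply: positive_ext (positiveC ler01) => s; rewrite /potts opprB addrC subrK.
Qed.

Definition local_on U F : Prop :=
  forall s s', {in U, s =1 s'} -> F s = F s'.

Lemma local_onS U W F : U \subset W -> local_on U F -> local_on W F.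
Proof. by move=> UW lF s s' eq_ss'; apply: lF => i /(subsetP UW)/eq_ss'. Qed.

Lemma local_onM U F G : local_on U F -> local_on U G ->
  local_on U (fun s => F s * G s).
Proof. by move=> lF lG s s' ss'; rewrite (lF _ _ ss') (lG _ _ ss'). Qed.

Lemma local_on_prod U (I : finType) (A : {set I}) (F : I -> config -> R) :
  (forall e, e \in A -> local_on U (F e)) ->
  local_on U (fun s => \prod_(e in A) F e s).
Proof. by move=> lF s s' ss'; apply: eq_bigr => e /lF; apply. Qed.

Lemma local_on_agree i j : local_on [set i; j] (agree i j).
Proof. by move=> s s' ss'; rewrite /agree !ss' ?set21 ?set22. Qed.

Lemma agree_ge0 i j s : 0 <= agree i j s.
Proof. by rewrite mulr_ge0 ?ler0n. Qed.

Lemma agree_le i j s : agree i j s <= q%:R.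
Proof. by rewrite ler_piMr ?ler0n // lern1 leq_b1. Qed.

Let upd s i (c : 'I_q) : config := [ffun k => if k == i then c else s k].

(** Drawing again the label of [i] exchanges the old and the new label, which is
an involution on pairs. *)
Lemma sum_resample i F :
  \sum_(s : config) \sum_(c : 'I_q) F (upd s i c) = q%:R * \sum_(s : config) F s.
Proof.
pose swap (p : config * 'I_q) := (upd p.1 i p.2, p.1 i).
have swapK : involutive swap.
  case=> s c; rewrite /swap /=; congr pair; last by rewrite ffunE eqxx.
  by apply/ffunP => k; rewrite !ffunE; case: eqP => // ->.
rewrite pair_big /= (reindex_inj (inv_inj swapK)) /=.
rewrite -(pair_big xpredT xpredT (fun s c => F (upd (swap (s, c)).1 i (swap (s, c)).2))) /=.
rewrite mulr_sumr; apply: eq_bigr => s _.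
rewrite (eq_bigr (fun=> F s)) ?sumr_const ?card_ord ?mulr_natl // => c _.
by congr F; apply/ffunP => k; rewrite !ffunE; case: eqP => // ->.
Qed.

Lemma sum_agree_fresh i j F : i != j -> local_on (~: [set j]) F ->
  \sum_(s : config) F s * agree i j s = \sum_(s : config) F s.
Proof.
move=> ij lF; have q0 : q%:R != 0 :> R by rewrite pnatr_eq0 -lt0n.
apply: (mulfI q0); rewrite -(sum_resample j) mulr_sumr; apply: eq_bigr => s _.
rewrite (eq_bigr (fun c => F s * (q%:R * (s i == c)%:R))); last first.
  move=> c _; rewrite /agree !ffunE eqxx (negPf ij); congr (_ * _).
  by apply: lF => k; rewrite !inE ffunE => /negPf->.
rewrite -!mulr_sumr (bigD1 (s i)) //= eqxx big1 ?addr0; last first.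
  by move=> c; rewrite eq_sym => /negPf->.
by rewrite mulr1 mulrC.
Qed.

Lemma sum_potts_fresh i j F : i != j -> local_on (~: [set j]) F ->
  \sum_(s : config) F s * potts i j s = 0.
Proof.
move=> ij lF; under eq_bigr do rewrite mulrBr mulr1.
by rewrite sumrB sum_agree_fresh // subrr.
Qed.

(** Labels are independent: exchanging the parts inside [U] of two
configurations is an involution. *)
Lemma sum_local_indep U F G : local_on U F -> local_on (~: U) G ->
  (\sum_(s : config) F s * G s) * #|{: config}|%:R =
  (\sum_(s : config) F s) * (\sum_(s : config) G s).
Proof.
move=> lF lG; rewrite mulr_suml.
pose mix s s' : config := [ffun k => if k \in U then s k else s' k].
pose swap (p : config * config) := (mix p.1 p.2, mix p.2 p.1).
have swapK : involutive swap.
  by case=> s s'; congr pair; apply/ffunP => k; rewrite !ffunE /=; case: (k \in U).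
rewrite mulr_suml; under [RHS]eq_bigr do rewrite mulr_sumr.
rewrite [RHS]pair_big /= (reindex_inj (inv_inj swapK)) /=.
rewrite (eq_bigr (fun p : config * config => F p.1 * G p.1)); last first.
  move=> [s s'] _ /=; congr (_ * _); [apply: lF | apply: lG] => k.
    by move=> kU; rewrite ffunE kU.
  by rewrite inE ffunE => /negPf->.
rewrite -(pair_big xpredT xpredT (fun s s' : config => F s * G s)) /=.
by apply: eq_bigr => s _; rewrite sumr_const mulr_natr.
Qed.

End PottsCone.

(** * The coefficients of the certificate *)

Lemma prod_1D_subsets (R : comPzRingType) (E : finType) (D : {set E}) (y : E -> R) :
  \prod_(e in D) (1 + y e) = \sum_(T : {set E} | T \subset D) \prod_(e in T) y e.
Proof.
move: {2}#|D| (erefl #|D|) => m; elim: m D => [|m IH] D.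
  move/eqP; rewrite cards_eq0 => /eqP->; rewrite big_set0.
  rewrite (big_pred1 set0) ?big_set0 // => T; exact: subset0.
move=> cD; have /card_gt0P[e eD] : (0 < #|D|)%N by rewrite cD.
have cDe : #|D :\ e| = m by apply: succn_inj; rewrite -cD (cardsD1 e D) eD.
rewrite (big_setD1 e) //= (IH _ cDe) mulrDl mul1r mulr_sumr.
rewrite [RHS](bigID (fun T : {set E} => e \in T)) /= addrC; congr (_ + _).
  by apply: eq_bigl => T; rewrite subsetD1.
rewrite [RHS](reindex_onto (fun T => e |: T) (fun T => T :\ e)) /=; last first.
  by move=> T /andP[_ eT]; rewrite setD1K.
apply: eq_big => [T|T TD].
  rewrite setU11 andbT subsetD1 subUset sub1set eD /=; congr (_ && _).
  by apply/idP/eqP => [/setU1K//|<-]; rewrite !inE eqxx.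
have eT : e \notin T by move: TD; rewrite subsetD1 => /andP[].
by rewrite big_setU1.
Qed.

(** Solve by increasing size of [B]: the only unknown of full size in the
equation of [B] is [c B]. *)
Lemma triangular_solve (R : fieldType) (E : finType) (A : {set E} -> {set E} -> R)
    (b : {set E} -> R) : (forall B, A B B != 0) ->
  exists c : {set E} -> R, forall B : {set E}, \sum_(T : {set E} | T \subset B) c T * A T B = b B.
Proof.
move=> A0.
suff [c cP] : exists c : {set E} -> R, forall B : {set E}, (#|B| < #|E|.+1)%N ->
    \sum_(T : {set E} | T \subset B) c T * A T B = b B.
  by exists c => B; apply: cP; rewrite ltnS max_card.
elim: #|E|.+1 => [|m [c cP]]; first by exists (fun=> 0).
exists (fun B : {set E} => if (#|B| < m)%N then c B else
  (b B - \sum_(T : {set E} | T \proper B) c T * A T B) / A B B) => B.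
rewrite ltnS leq_eqVlt => /orP[/eqP cB|cB]; last first.
  rewrite -(cP _ cB); apply: eq_bigr => T TB.
  by rewrite (leq_ltn_trans (subset_leq_card TB) cB).
rewrite (bigD1 B) //= cB ltnn divfK //.
rewrite [X in _ + X](_ : _ = \sum_(T : {set E} | T \proper B) c T * A T B).
  by rewrite subrK.
apply: eq_big => T; first by rewrite properEneq andbC.
by case/andP=> TB TneB; rewrite -cB proper_card // properEneq TneB.
Qed.

Section Coefficients.
Variables (R : realFieldType) (V E : finType) (q : nat).
Variables (src tgt : E -> V) (lam : R) (u v : V).
Hypothesis q_gt0 : (0 < q)%N.
Hypothesis src_neq_tgt : forall e, src e != tgt e.
Hypothesis lam_ge0 : 0 <= lam.
Hypothesis lam_le1 : lam <= 1.
Hypothesis u_neq_v : u != v.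
Local Notation config := {ffun V -> 'I_q}.
Implicit Types (s : config) (A B H T : {set E}) (e : E) (y : V) (U : {set V}).

Definition ends e : {set V} := [set src e; tgt e].
Let W : {set V} := [set u; v].
Definition kern e s : R := potts R (src e) (tgt e) s.
Definition bond e s : R := agree R (src e) (tgt e) s.
Definition gprod A s : R := \prod_(e in A) (1 + lam * kern e s).
Definition kprod A s : R := \prod_(e in A) (lam * kern e s).
Definition signal s : R := q%:R^-1 * potts R u v s.
Definition partition_fun A : R := \sum_(s : config) gprod A s.
Local Notation N := (#|{: config}|%:R : R).

Lemma card_ends e : #|ends e| = 2.
Proof. by rewrite cards2 src_neq_tgt. Qed.

Lemma N_gt0 : 0 < N.
Proof. by rewrite card_ffun card_ord ltr0n expn_gt0 q_gt0. Qed.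

Lemma gweight_ge0 e s : 0 <= 1 + lam * kern e s.
Proof.
rewrite /kern /potts; have := agree_ge0 R (src e) (tgt e) s.
have := lam_ge0; have := lam_le1; nra.
Qed.

Lemma gprod_ge0 A s : 0 <= gprod A s.
Proof. by apply: prodr_ge0 => e _; apply: gweight_ge0. Qed.

Lemma positive_kern e : positive (kern e). Proof. exact: positive_potts. Qed.

Lemma positive_lkern e : positive (fun s => lam * kern e s).
Proof. by apply: positiveM; [apply: positiveC | apply: positive_kern]. Qed.

Lemma positive_gweight e : positive (fun s => 1 + lam * kern e s).
Proof. by apply: positiveD; [apply: positiveC | apply: positive_lkern]. Qed.

Lemma positive_gprod A : positive (gprod A).
Proof. exact/positive_prod/positive_gweight. Qed.

Lemma positive_kprod A : positive (kprod A).
Proof. exact/positive_prod/positive_lkern. Qed.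

(** Positivity makes the interaction raise the partition function above its
value without any edge. *)
Lemma partition_fun_ge A : N <= partition_fun A.
Proof.
have -> : N = \sum_(s : config) \prod_(e in A) 1.
  transitivity (\sum_(s : config) (1 : R)); first by rewrite sumr_const.
  by apply: eq_bigr => s _; rewrite big1.
apply: (@dominated_sum_le R V q q_gt0 _ (gprod A)).
apply: (@dominated_prod R V q E A (fun _ _ => 1) (fun e s => 1 + lam * kern e s)) => e.
  exact: positiveC.
by apply: positive_ext (positive_lkern e) => s; rewrite addrC addKr.
Qed.

Lemma partition_fun_gt0 A : 0 < partition_fun A.
Proof. exact: lt_le_trans N_gt0 (partition_fun_ge A). Qed.

Lemma local_bond e : local_on (ends e) (bond e).
Proof. exact: local_on_agree. Qed.

Lemma local_kern e : local_on (ends e) (kern e).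
Proof. by move=> s s' ss'; rewrite /kern /potts -!/(bond e _) (local_bond ss'). Qed.

Lemma local_gprod A U : (forall e, e \in A -> ends e \subset U) ->
  local_on U (gprod A).
Proof.
move=> AU; apply: local_on_prod => e /AU/local_onS; apply.
by move=> s s' ss'; rewrite (local_kern ss').
Qed.

Lemma local_kprod A U : (forall e, e \in A -> ends e \subset U) ->
  local_on U (kprod A).
Proof.
move=> AU; apply: local_on_prod => e /AU/local_onS; apply.
by move=> s s' ss'; rewrite (local_kern ss').
Qed.

Lemma local_signal U : W \subset U -> local_on U signal.
Proof.
move=> /local_onS; apply=> s s' ss'.
by rewrite /signal /potts (local_on_agree R ss').
Qed.

Lemma ends_other e y : y \in ends e -> exists2 w, w != y &
  forall s, bond e s = agree R w y s.
Proof.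
case/set2P=> ->; last by exists (src e).
by exists (tgt e) => [|s]; rewrite 1?eq_sym // /bond /agree eq_sym.
Qed.

Lemma sum_bond_fresh e y F : y \in ends e -> local_on (~: [set y]) F ->
  \sum_(s : config) F s * bond e s = \sum_(s : config) F s.
Proof.
case/ends_other=> w wy bE lF; under eq_bigr do rewrite bE.
exact: sum_agree_fresh.
Qed.

Lemma sum_kern_fresh e y F : y \in ends e -> local_on (~: [set y]) F ->
  \sum_(s : config) F s * (lam * kern e s) = 0.
Proof.
case/ends_other=> w wy bE lF.
under eq_bigr do rewrite mulrCA /kern /potts -/(bond e _) bE.
by rewrite -mulr_sumr (sum_potts_fresh q_gt0 wy lF) mulr0.
Qed.

(** Explore [B] from [W0]. An edge to a new vertex integrates to 1, since the
label there is fresh; an edge between known vertices is at most [q]. *)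
Lemma sum_attached_bonds W0 B F : attached ends W0 B ->
    local_on W0 F -> (forall s, 0 <= F s) ->
  \sum_(s : config) F s * \prod_(e in B) bond e s <=
    q%:R ^+ surplus ends W0 B * \sum_(s : config) F s.
Proof.
move=> aB; move: W0 B aB F; apply: (attached_rect card_ends) => [W0|W0 B e eB eW aB IH] F lF F0.
  by rewrite surplus0 mul1r; under eq_bigr do rewrite big_set0 mulr1.
rewrite (surplus_cons card_ends) // exprD -mulrA.
under eq_bigr do rewrite big_setU1 //= mulrA.
apply: le_trans (IH (fun s => F s * bond e s) _ _) _.
- apply: local_onM; first exact: local_onS (subsetUl _ _) lF.
  exact: local_onS (subsetUr _ _) (local_bond (e:=e)).
- by move=> s; rewrite mulr_ge0 // agree_ge0.
rewrite mulrCA ler_wpM2l ?exprn_ge0 ?ler0n //.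
have [_|/subsetPn[y ye yW]] := boolP (ends e \subset W0).
  rewrite expr1 mulr_sumr; apply: ler_sum => s _.
  by rewrite mulrC ler_wpM2r // agree_le.
rewrite mul1r (sum_bond_fresh ye) //.
by apply: local_onS lF; rewrite subsetC sub1set inE.
Qed.


(** Matrix entry of the system for the coefficients, in the row of [A :|: B], for
disjoint [A] and [B]; the entry on the diagonal is a partition function. *)
Definition mixed A B : R := \sum_(s : config) gprod A s * kprod B s.
Definition signal_mean B : R := \sum_(s : config) kprod B s * signal s.

Lemma mixed0 A : mixed A set0 = partition_fun A.
Proof. by apply: eq_bigr => s _; rewrite /kprod big_set0 mulr1. Qed.

Lemma sum_agree : \sum_(s : config) agree R u v s = N.
Proof.
have lF : local_on (~: [set v]) (fun _ : config => 1 : R) by [].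
have := sum_agree_fresh q_gt0 u_neq_v lF; rewrite sumr_const => <-.
by apply: eq_bigr => s _; rewrite mul1r.
Qed.

Lemma exists_coefficients : exists c : {set E} -> R,
  forall B, \sum_(A : {set E} | A \subset B) c A * mixed A (B :\: A) = signal_mean B.
Proof.
apply: triangular_solve => B.
by rewrite setDv mixed0 lt0r_neq0 // partition_fun_gt0.
Qed.

Lemma mixed_ge0 A B : 0 <= mixed A B.
Proof.
apply: positive_sum_ge0 => //.
by apply: positiveM; [apply: positive_gprod | apply: positive_kprod].
Qed.

Lemma kprod_lam B s : kprod B s = lam ^+ #|B| * \prod_(e in B) kern e s.
Proof. by rewrite /kprod big_split prodr_const. Qed.

(** Replacing each k_e by k_e + 1 only adds positive terms. Passing to absolute
values instead would cost a constant factor per edge, too much for edge sets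
whose size is a power of n. *)
Lemma dominated_kprod B :
  dominated (kprod B) (fun s => lam ^+ #|B| * \prod_(e in B) bond e s).
Proof.
have dom : dominated (fun s => lam ^+ #|B| * \prod_(e in B) kern e s)
                     (fun s => lam ^+ #|B| * \prod_(e in B) bond e s).
  apply: dominatedM; last 1 first.
  - apply: dominated_prod => e; first exact: positive_kern.
    exact: dominated_potts_agree.
  - by apply: positiveC; rewrite exprn_ge0.
  - exact/positive_prod/positive_kern.
  - exact: dominated_refl.
by apply: positive_ext dom => s; rewrite kprod_lam.
Qed.

Lemma mixed_le A B : attached ends (verts ends W A) B ->
  mixed A B <=
    lam ^+ #|B| * q%:R ^+ surplus ends (verts ends W A) B * partition_fun A.
Proof.
move=> aB.
have : mixed A B <= \sum_(s : config)
    gprod A s * (lam ^+ #|B| * \prod_(e in B) bond e s).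
  apply: dominated_sum_le => //; apply: dominatedM.
  - exact: positive_gprod.
  - exact: positive_kprod.
  - exact: dominated_refl.
  - exact: dominated_kprod.
move/le_trans; apply; under eq_bigr do rewrite mulrCA.
rewrite -mulr_sumr -mulrA ler_wpM2l ?exprn_ge0 //.
apply: sum_attached_bonds => // [|s]; last exact: gprod_ge0.
by apply: local_gprod => e; apply: ends_sub_verts.
Qed.

Lemma signal_mean_bounds B : attached ends W B ->
  0 <= signal_mean B <= lam ^+ #|B| * (q%:R ^+ surplus ends W B / q%:R) * N.
Proof.
move=> aB; have iq_ge0 : 0 <= q%:R^-1 :> R by rewrite invr_ge0 ler0n.
have psignal : positive signal.
  by apply: positiveM; [apply: positiveC | apply: positive_potts].
apply/andP; split.
  by apply: positive_sum_ge0 => //; apply: positiveM => //; apply: positive_kprod.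
have : signal_mean B <= \sum_(s : config)
    (lam ^+ #|B| * \prod_(e in B) bond e s) * (q%:R^-1 * agree R u v s).
  apply: dominated_sum_le => //; apply: dominatedM => //.
  - exact: positive_kprod.
  - exact: dominated_kprod.
  apply: dominatedM.
  - exact: positiveC.
  - exact: positive_potts.
  - exact: dominated_refl.
  exact: dominated_potts_agree.
move/le_trans; apply.
rewrite (eq_bigr (fun s => lam ^+ #|B| / q%:R *
  (agree R u v s * \prod_(e in B) bond e s))); last by move=> s _; ring.
rewrite -mulr_sumr -!mulrA ler_wpM2l ?exprn_ge0 // [leRHS]mulrCA ler_wpM2l //.
apply: le_trans (sum_attached_bonds aB (local_on_agree R (i:=u) (j:=v)) _) _.
  by move=> s; apply: agree_ge0.
rewrite ler_wpM2l ?exprn_ge0 ?ler0n //.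
by rewrite sum_agree.
Qed.

Section SolvedCoefficients.
Variable c : {set E} -> R.
Hypothesis c_eq : forall B,
  \sum_(A : {set E} | A \subset B) c A * mixed A (B :\: A) = signal_mean B.

Lemma coef_rec B : c B * partition_fun B =
  signal_mean B - \sum_(A : {set E} | A \proper B) c A * mixed A (B :\: A).
Proof.
rewrite -c_eq (bigD1 B) //= setDv mixed0.
rewrite [X in _ + X - _](eq_bigl (fun A : {set E} => A \proper B)) ?addrK // => A.
by rewrite properEneq andbC.
Qed.

Lemma coef_eq0 B : c B * partition_fun B = 0 -> c B = 0.
Proof.
by move/eqP; rewrite mulf_eq0 (negPf (lt0r_neq0 (partition_fun_gt0 B))) orbF => /eqP.
Qed.

Lemma coef_set0 : c set0 = 0.
Proof.
apply: coef_eq0; rewrite coef_rec big_pred0 => [|A]; last first.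
  by rewrite properE sub0set andbF.
rewrite subr0 /signal_mean /kprod; under eq_bigr do rewrite big_set0 mul1r.
rewrite -mulr_sumr.
by rewrite /potts sumrB sum_agree sumr_const subrr mulr0.
Qed.

Lemma sub_setC1 y e : y \notin ends e -> ends e \subset ~: [set y].
Proof. by rewrite subsetC sub1set in_setC. Qed.

(** Every term of the equation for [c B] in which the edge [e] carries a kernel
vanishes on averaging over the label of [y]; in the others [e] is a leaf edge of
a smaller set. *)
Lemma coef_leaf B y e : y \notin W -> edges_at ends B y = [set e] -> c B = 0.
Proof.
move=> yW; move: {2}#|B| (leqnn #|B|) => m; elim: m B => [|m IH] B Bm By.
  by move: Bm; rewrite leqn0 cards_eq0 => /eqP->; exact: coef_set0.
have [eB ye] : e \in B /\ y \in ends e.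
  by apply/andP; have := set11 e; rewrite -By inE.
have other f : f \in B -> f != e -> y \notin ends f.
  move=> fB fe; apply: contra fe => yf.
  by rewrite -in_set1 -By inE fB.
have peel A s : e \in A -> kprod A s = kprod (A :\ e) s * (lam * kern e s).
  by move=> eA; rewrite /kprod (big_setD1 e) //= mulrC.
have lk A : A \subset B -> local_on (~: [set y]) (kprod (A :\ e)).
  move=> AB; apply: local_kprod => f /setD1P[fe /(subsetP AB) fB].
  exact/sub_setC1/other.
apply: coef_eq0; rewrite coef_rec /signal_mean.
rewrite (eq_bigr (fun s => (kprod (B :\ e) s * signal s) * (lam * kern e s))); last first.
  by move=> s _; rewrite (peel _ _ eB); ring.
rewrite (sum_kern_fresh ye); last first.
  apply: local_onM; first exact: lk.
  by apply: local_signal; rewrite subsetC sub1set inE.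
rewrite big1 ?subr0 // => A /[dup] ltAB /proper_sub AB.
have [eA|eA] := boolP (e \in A).
  rewrite (IH A) ?mul0r //.
    by rewrite -ltnS (leq_trans (proper_card ltAB)).
  apply/setP => g; rewrite in_set1 inE; have [->|ge] := eqVneq g e; first by rewrite eA ye.
  by apply/negP => /andP[/(subsetP AB) gB]; apply/negP/other.
rewrite /mixed (eq_bigr (fun s => (gprod A s * kprod (B :\: A :\ e) s) * (lam * kern e s))).
  rewrite (sum_kern_fresh ye) ?mulr0 //; apply: local_onM; last by apply: lk; apply: subsetDl.
  apply: local_gprod => g gA; apply/sub_setC1/other; first exact: (subsetP AB).
  by apply: contraNneq eA => <-.
by move=> s _; rewrite (peel (B :\: A)) ?inE ?eA //; ring.
Qed.

(** The labels outside [U] are independent of those inside. So the equation for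
[c B] is the equation for the part of [B] inside [U] times a constant, plus the
terms of smaller sets that are detached as well. *)
Lemma coef_detached B U e0 : W \subset U ->
    (forall e, e \in B -> ~~ [disjoint ends e & U] -> ends e \subset U) ->
    e0 \in B -> ~~ (ends e0 \subset U) -> c B = 0.
Proof.
move=> WU; move: {2}#|B| (leqnn #|B|) => m; elim: m B e0 => [|m IH] B e0 Bm closedU e0B e0U.
  by move: Bm; rewrite leqn0 cards_eq0 => /eqP->; exact: coef_set0.
(* By closedness, the edges of [B2] lie entirely outside [U]. *)
pose B1 := [set e in B | ends e \subset U]; pose B2 := B :\: B1.
have B1B : B1 \subset B by apply/subsetP => e; rewrite inE => /andP[].
have B1U e : e \in B1 -> ends e \subset U by rewrite inE => /andP[].
have B2U e : e \in B2 -> ends e \subset ~: U.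
  rewrite !inE negb_and => /andP[] /orP[/negP//|nU] eB.
  rewrite subsetC -disjoints_subset disjoint_sym.
  by apply: contraR nU; apply: closedU.
have split_kprod A s : A \subset B1 ->
    kprod (B :\: A) s = kprod (B1 :\: A) s * kprod B2 s.
  move=> AB1; rewrite /kprod (big_setID B1) /=; congr (_ * _); apply: eq_bigl => e.
    by rewrite !inE; case: (e \in A); case: (e \in B); rewrite ?andbF.
  by rewrite !inE; case: (e \in A) (subsetP AB1 e) => [/(_ isT)|_];
    rewrite ?inE; [move=> /andP[-> ->] | rewrite andbA].
pose K2 := \sum_(s : config) kprod B2 s.
have split_sum F A : A \subset B1 -> local_on U F ->
    (\sum_(s : config) F s * kprod (B :\: A) s) * N =
    (\sum_(s : config) F s * kprod (B1 :\: A) s) * K2.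
  move=> AB1 lF; rewrite -(sum_local_indep (U := U)).
  - by congr (_ * _); apply: eq_bigr => s _; rewrite split_kprod // mulrA.
  - apply: local_onM => //; apply: local_kprod => e /setDP[eB1 _]; exact: B1U.
  - exact: local_kprod.
apply: coef_eq0; apply: (mulIf (lt0r_neq0 N_gt0)); rewrite mul0r coef_rec mulrBl.
apply/eqP; rewrite subr_eq0; apply/eqP.
transitivity (signal_mean B1 * K2).
  rewrite /signal_mean; under eq_bigr do rewrite mulrC; under [in RHS]eq_bigr do rewrite mulrC.
  have := split_sum signal set0 (sub0set _) (local_signal WU).
  by rewrite !setD0.
rewrite -c_eq [in RHS](bigID (fun A : {set E} => A \subset B1)) /= [X in _ + X]big1 ?addr0.
  rewrite !mulr_suml; apply: eq_big => [A|A AB1].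
    apply/idP/andP => [AB1|[]//]; split=> //; apply/properP.
    split; first exact: subset_trans AB1 B1B.
    exists e0 => //; apply: contra e0U => /(subsetP AB1); exact: B1U.
  rewrite -!mulrA; congr (_ * _); apply/esym; apply: split_sum => //.
  by apply: local_gprod => e /(subsetP AB1)/B1U.
move=> A /andP[/[dup] ltAB /proper_sub AB /subsetPn[e eA eB1]].
rewrite (IH A e) ?mul0r //.
- by rewrite -ltnS (leq_trans (proper_card ltAB)).
- by move=> e' /(subsetP AB); apply: closedU.
- by move: eB1; rewrite inE (subsetP AB).
Qed.

Lemma coef_core B : c B != 0 -> core ends W B.
Proof.
move=> cB; split=> [U WU closedU e eB|y yW].
  by apply: contraNT cB => eU; apply/eqP/(coef_detached WU closedU eB).
by apply: contraNN cB => /cards1P[e]; move/(coef_leaf yW) => ->.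
Qed.

(** In the recursion for [c B], the kernels outside a subcore [A] contribute [q]
to the power of the difference of surpluses ([mixed_le]), so that the terms of
all subcores have the same order in lambda and q; [sum_subcores] adds them. *)
Lemma coef_bound B M : (#|B| <= M)%N -> c B != 0 ->
  `|c B| * partition_fun B <=
    lam ^+ #|B| * (q%:R ^+ surplus ends W B / q%:R) *
    (2 * M)%:R ^+ surplus ends W B * N.
Proof.
move: {2}#|B|.+1 (ltnSn #|B|) => m; elim: m B => // m IH B; rewrite ltnS => Bm BM cB.
have coreB := coef_core cB; have [aB lB] := coreB.
(* Positive since the empty set has coefficient 0: the signal is centred. *)
have M0 : (0 < M)%N.
  rewrite (leq_trans _ BM) // card_gt0; apply: contraNneq cB => ->.
  by rewrite coef_set0.
rewrite -[X in _ * X](gtr0_norm (partition_fun_gt0 B)) -normrM coef_rec.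
pose Q : R := lam ^+ #|B| * (q%:R ^+ surplus ends W B / q%:R) * N.
pose F : {set {set E}} := [set A : {set E} | (A \proper B) && (c A != 0)].
have FP A : A \in F -> core ends W A /\ A \proper B.
  by rewrite inE => /andP[AB /coef_core].
have Q0 : 0 <= Q by rewrite !mulr_ge0 ?exprn_ge0 ?invr_ge0 ?ler0n.
have term A : A \in F ->
    `|c A * mixed A (B :\: A)| <= Q * (2 * M)%:R ^+ surplus ends W A.
  move=> AF; have [coreA /[dup] AB /proper_sub sAB] := FP A AF.
  have cA : c A != 0 by move: AF; rewrite inE => /andP[].
  have AltB := proper_card AB.
  have aD := attached_setD aB sAB.
  rewrite normrM (ger0_norm (mixed_ge0 _ _)).
  apply: le_trans (ler_wpM2l (normr_ge0 _) (mixed_le aD)) _.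
  rewrite mulrCA mulrC.
  apply: le_trans (ler_wpM2r _ (IH A (leq_trans AltB Bm) (leq_trans (ltnW AltB) BM) cA)) _.
    by rewrite !mulr_ge0 ?exprn_ge0 ?ler0n.
  rewrite /Q; have DBA : A :|: (B :\: A) = B.
    by apply/setP => f; rewrite !inE; have [/(subsetP sAB)->|] := boolP (f \in A).
  have dAB : [disjoint A & B :\: A].
    by rewrite -setI_eq0 setIDA setIC -setIDA setDv setI0.
  have -> : #|B| = (#|A| + #|B :\: A|)%N.
    by rewrite cardsD (setIidPr sAB) subnKC // subset_leq_card.
  have -> : surplus ends W B =
      (surplus ends W A + surplus ends (verts ends W A) (B :\: A))%N.
    by rewrite -surplus_setU ?DBA //; [exact: card_ends | exact: coreA.1].
  by rewrite !exprD le_eqVlt; apply/orP; left; apply/eqP; ring.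
apply: le_trans (ler_normB _ _) _.
apply: le_trans (_ : Q + Q * (\sum_(A in F) (2 * M) ^ surplus ends W A)%:R <= _).
  apply: lerD.
    have /andP[sm_ge0 sm_le] := signal_mean_bounds aB.
    by rewrite ger0_norm.
  apply: le_trans (ler_norm_sum _ _ _) _.
  rewrite (bigID (fun A => c A != 0)) /= [X in _ + X]big1 ?addr0; last first.
    by move=> A /andP[_ /negPn/eqP->]; rewrite mul0r normr0.
  rewrite natr_sum mulr_sumr (eq_bigl (mem F)); last by move=> A; rewrite !inE.
  by apply: ler_sum => A AF; rewrite natrX term.
have := sum_subcores card_ends coreB BM M0 FP.
rewrite -(ler_nat R) natrX -[_.+1]addn1 natrD => le.
rewrite -{1}[Q]mulr1 -mulrDr addrC [leRHS](_ : _ = Q * (2 * M)%:R ^+ surplus ends W B).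
  by rewrite ler_wpM2l.
by rewrite /Q; ring.
Qed.

(** Add up the equations of all subsets of [B], using that a product of factors
1 + lambda k_e is the sum over subsets of the products of lambda k_e. *)
Lemma sum_coef B :
  (\sum_(A : {set E} | A \subset B) c A) * partition_fun B =
  \sum_(s : config) gprod B s * signal s.
Proof.
have gk (D : {set E}) s : gprod D s = \sum_(T : {set E} | T \subset D) kprod T s.
  exact: prod_1D_subsets.
transitivity (\sum_(T : {set E} | T \subset B) signal_mean T); last first.
  rewrite exchange_big /=; apply: eq_bigr => s _.
  by rewrite gk mulr_suml.
under [RHS]eq_bigr do rewrite -c_eq big_mkcond /=.
rewrite exchange_big /= [LHS]mulr_suml big_mkcond /=; apply: eq_bigr => A _.
rewrite -big_mkcondr /= -mulr_sumr -[LHS]/(if _ then _ else _).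
case: ifPn => [AB|nAB]; last first.
  rewrite big_pred0 ?mulr0 // => T; apply/negP => /andP[TB AT].
  by move/negP: nAB; apply; apply: subset_trans AT TB.
congr (_ * _); rewrite exchange_big /=; apply: eq_bigr => s _.
rewrite -mulr_sumr /gprod (big_setID A) /= (setIidPr AB); congr (_ * _).
rewrite -/(gprod _ s) gk.
rewrite [RHS](reindex_onto (fun D => A :|: D) (fun T => T :\: A)) /=.
  apply: eq_big => [D|D DBA].
    rewrite subUset AB subsetUl andbT subsetD /=; congr (_ && _).
    rewrite setDUl setDv set0U; apply/idP/eqP => [|<-].
      by move/setDidPl.
    by rewrite -setI_eq0 setIDAC -setIDA setDv setI0.
  congr (kprod _ s); rewrite setDUl setDv set0U; apply/esym/setDidPl.
  by move: DBA; rewrite subsetD => /andP[].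
by move=> T /andP[TB AT]; apply/setP=> f; rewrite !inE;
   have [/(subsetP AT)->|] := boolP (f \in A).
Qed.

End SolvedCoefficients.

End Coefficients.

(** * The certificate in the block model *)

(** The quadratic polynomial in [t] given by the sum of w (f t - g)^2 is
nonnegative; evaluate it at its minimum. *)
Lemma weighted_cauchy_schwarz (R : realFieldType) (I : finType) (w f g : I -> R) :
  (forall i, 0 <= w i) ->
  (\sum_i w i * (f i * g i)) ^+ 2 <=
    (\sum_i w i * f i ^+ 2) * (\sum_i w i * g i ^+ 2).
Proof.
move=> w0; pose F := \sum_i w i * f i ^+ 2; pose G := \sum_i w i * g i ^+ 2.
pose H := \sum_i w i * (f i * g i); rewrite -/F -/G -/H.
have F0 : 0 <= F by apply: sumr_ge0 => i _; rewrite mulr_ge0 ?sqr_ge0.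
have quad t : 0 <= F * t ^+ 2 - 2 * H * t + G.
  have -> : F * t ^+ 2 - 2 * H * t + G = \sum_i w i * (f i * t - g i) ^+ 2.
    rewrite /F /G /H mulr_sumr !mulr_suml -sumrB -big_split /=.
    by apply: eq_bigr => i _; ring.
  by apply: sumr_ge0 => i _; rewrite mulr_ge0 ?sqr_ge0.
have [F_eq0|F_neq0] := eqVneq F 0.
  have wf i : w i * f i ^+ 2 = 0.
    have /eqP := F_eq0; rewrite psumr_eq0 => [/allP/(_ i)|j _]; last first.
      by rewrite mulr_ge0 ?sqr_ge0.
    by rewrite mem_index_enum => /(_ isT)/eqP.
  have -> : H = 0.
    apply: big1 => i _; have /eqP := wf i.
    by rewrite mulf_eq0 sqrf_eq0 => /orP[] /eqP->; rewrite !(mul0r, mulr0).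
  by rewrite F_eq0 mul0r expr0n.
have Fp : 0 < F by rewrite lt_def F_neq0.
have := quad (H / F).
have -> : F * (H / F) ^+ 2 - 2 * H * (H / F) + G = (F * G - H ^+ 2) / F by field.
by rewrite pmulr_lge0 ?invr_gt0 // subr_ge0.
Qed.


Definition esrc n (e : edge n) : 'I_n := (val e).1.
Definition etgt n (e : edge n) : 'I_n := (val e).2.

Lemma esrc_neq_etgt n (e : edge n) : esrc e != etgt e.
Proof. by rewrite -val_eqE neq_ltn (valP e). Qed.

Lemma edge_ends_inj n : injective (ends (@esrc n) (@etgt n)).
Proof.
move=> e f ef; apply: val_inj.
have : esrc e \in ends (@esrc n) (@etgt n) f by rewrite -ef set21.
have : etgt e \in ends (@esrc n) (@etgt n) f by rewrite -ef set22.
have := valP e; have := valP f; rewrite {ef} /ends /esrc /etgt.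
case: (val e) (val f) => [e1 e2] [f1 f2] /= lf le /set2P[] e2E /set2P[] e1E; subst=> //.
- by rewrite ltnn in le.
- by move: lf le; lia.
- by rewrite ltnn in le.
Qed.

Lemma bernoulli_ineq (R : realFieldType) (x : R) m :
  0 <= x <= 1 -> 1 - m%:R * x <= (1 - x) ^+ m.
Proof.
move=> /andP[x0 x1]; elim: m => [|m IH]; first by rewrite mul0r subr0.
rewrite exprS -addn1 natrD.
apply: le_trans (_ : (1 - x) * (1 - m%:R * x) <= _); last first.
  by rewrite ler_wpM2l // subr_ge0.
have : 0 <= m%:R * (x * x) :> R by rewrite !mulr_ge0 ?ler0n.
by lra.
Qed.

Section BlockModel.
Variables (R : realType) (n q : nat) (a b : R).

Let half_le (y k : R) : 1 - k <= y -> k <= 2^-1 -> 1 <= 2 * y.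
Proof. by lra. Qed.

Let square_regroup (P L S Q M C : R) : Q != 0 -> C != 0 ->
  2 * P * ((L * (S / Q) * M * C) ^+ 2 / C) =
  2 / Q ^+ 2 * C * (P * L ^+ 2 * (M * S) ^+ 2).
Proof. by move=> Q0 C0; field; rewrite ?Q0 ?C0. Qed.

Hypothesis n_gt0 : (0 < n)%N.
Hypothesis q_gt1 : (1 < q)%N.
Hypothesis b_gt0 : 0 < b.
Hypothesis b_le_a : b <= a.
Hypothesis a_lt_n : a < n%:R.
Implicit Types (s : labeling n q) (Y : graph n) (A B : {set edge n}) (e : edge n).

Let lam : R := snr_lambda q a b.
Let p : R := avg_degree q a b / n%:R.
Let pr s e : R := edge_prob a b s e.
Let EE (F : labeling n q -> graph n -> R) : R := sbm_expectation a b F.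
Let ekern := @kern R 'I_n (edge n) q (@esrc n) (@etgt n).
Let eprod := @gprod R 'I_n (edge n) q (@esrc n) (@etgt n) lam.
Let efun := @partition_fun R 'I_n (edge n) q (@esrc n) (@etgt n) lam.

Lemma q_gt0 : (0 < q)%N. Proof. exact: ltnW. Qed.

Lemma qR_ge2 : 2 <= q%:R :> R. Proof. by rewrite ler_nat. Qed.

Lemma nR_gt0 : 0 < n%:R :> R. Proof. by rewrite ltr0n. Qed.

Lemma degree_gt0 : 0 < a + (q%:R - 1) * b.
Proof. by have := qR_ge2; have := b_gt0; have := b_le_a; nra. Qed.

Lemma snr_lambda_ge0 : 0 <= lam.
Proof. by rewrite divr_ge0 ?subr_ge0 // ltW // degree_gt0. Qed.

Lemma snr_lambda_le1 : lam <= 1.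
Proof.
rewrite ler_pdivrMr ?degree_gt0 // mul1r.
by have := qR_ge2; have := b_gt0; nra.
Qed.

Lemma edge_prob_potts s e : pr s e = p * (1 + lam * ekern e s).
Proof.
have q0 : q%:R != 0 :> R by rewrite pnatr_eq0 -lt0n q_gt0.
have n0 := lt0r_neq0 nR_gt0; have d0 := lt0r_neq0 degree_gt0.
rewrite /pr /edge_prob /ekern /kern /potts /agree /esrc /etgt /p /lam.
rewrite /snr_lambda /avg_degree; case: (_ == _); rewrite ?mulr1 ?mulr0; field; rewrite ?n0 ?q0 ?d0 ?andbT //=.
Qed.

Lemma edge_prob_gt0 s e : 0 < pr s e.
Proof.
rewrite divr_gt0 ?nR_gt0 //; case: ifP => // _.
exact: lt_le_trans b_gt0 b_le_a.
Qed.

Lemma edge_prob_le s e : pr s e <= a / n%:R.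
Proof. by rewrite ler_pM2r ?invr_gt0 ?nR_gt0 //; case: ifP. Qed.

Lemma edge_prob_lt1 s e : pr s e < 1.
Proof.
by apply: le_lt_trans (edge_prob_le s e) _; rewrite ltr_pdivrMr ?nR_gt0 // mul1r.
Qed.

Definition edge_weight s Y : R :=
  \prod_(e : edge n) (if Y e then pr s e else 1 - pr s e).

Lemma edge_weight_ge0 s Y : 0 <= edge_weight s Y.
Proof.
apply: prodr_ge0 => e _; case: ifP => _; first exact/ltW/edge_prob_gt0.
by rewrite subr_ge0 ltW // edge_prob_lt1.
Qed.

Lemma sum_edge_weight_prod s (phi : edge n -> bool -> R) :
  \sum_(Y : graph n) edge_weight s Y * \prod_e phi e (Y e) =
  \prod_e (pr s e * phi e true + (1 - pr s e) * phi e false).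
Proof.
rewrite (eq_bigr (fun Y : graph n =>
  \prod_e ((if Y e then pr s e else 1 - pr s e) * phi e (Y e)))); last first.
  by move=> Y _; rewrite [RHS]big_split.
rewrite -(bigA_distr_bigA (fun e y => (if y then pr s e else 1 - pr s e) * phi e y)) /=.
by apply: eq_bigr => e _; rewrite big_bool.
Qed.

Lemma expectationE F :
  EE F = q%:R^-1 ^+ n * \sum_(s : labeling n q) \sum_(Y : graph n) edge_weight s Y * F s Y.
Proof.
rewrite mulr_sumr; apply: eq_bigr => s _; rewrite mulr_sumr; apply: eq_bigr => Y _.
by rewrite mulrA.
Qed.

Lemma expectation_sum (I : Type) (r : seq I) (P : pred I) (k : I -> R) F :
  EE (fun s Y => \sum_(i <- r | P i) k i * F i s Y) =
  \sum_(i <- r | P i) k i * EE (F i).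
Proof.
rewrite expectationE; under [RHS]eq_bigr do rewrite expectationE mulrCA.
rewrite -mulr_sumr; congr (_ * _).
under eq_bigr => s _ do under eq_bigr => Y _ do rewrite mulr_sumr.
under eq_bigr do rewrite exchange_big /=.
rewrite exchange_big /=; apply: eq_bigr => i _.
rewrite mulr_sumr; apply: eq_bigr => s _; rewrite mulr_sumr; apply: eq_bigr => Y _.
by rewrite mulrCA.
Qed.

Lemma eq_expectation F G : (forall s Y, F s Y = G s Y) -> EE F = EE G.
Proof.
by move=> FG; apply: eq_bigr => s _; apply: eq_bigr => Y _; rewrite FG.
Qed.

Lemma expectation_cauchy_schwarz (F G : labeling n q -> graph n -> R) :
  EE (fun s Y => F s Y * G s Y) ^+ 2 <=
  EE (fun s Y => F s Y ^+ 2) * EE (fun s Y => G s Y ^+ 2).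
Proof.
rewrite /EE /sbm_expectation !pair_big /=.
apply: (@weighted_cauchy_schwarz R (labeling n q * graph n)%type
  (fun i => sbm_pmf a b i.1 i.2) (fun i => F i.1 i.2) (fun i => G i.1 i.2)) => i.
by rewrite mulr_ge0 ?exprn_ge0 ?invr_ge0 ?ler0n // edge_weight_ge0.
Qed.

(** The values of (Y_e - p_e) / (1 - p_e) at Y_e = 1 and Y_e = 0. *)
Definition noise s e (y : bool) : R := if y then 1 else - (pr s e / (1 - pr s e)).

Definition edge_monomial B Y : R := \prod_(e in B) (Y e)%:R.

Lemma edge_prob_neq1 s e : 1 - pr s e != 0.
Proof. by rewrite subr_eq0 eq_sym lt_eqF // edge_prob_lt1. Qed.

Lemma sum_edge_monomial s B :
  \sum_(Y : graph n) edge_weight s Y * edge_monomial B Y = \prod_(e in B) pr s e.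
Proof.
under [LHS]eq_bigr => Y _ do rewrite /edge_monomial [X in _ * X]big_mkcond /=.
rewrite (sum_edge_weight_prod s (fun e y => if e \in B then y%:R else 1)) [RHS]big_mkcond.
by apply: eq_bigr => e _; case: ifP => _ /=; ring.
Qed.

Let prod_merge (f g : edge n -> R) :
  (\prod_e f e) * (\prod_e g e) = \prod_e (f e * g e).
Proof. by rewrite big_split. Qed.

Lemma sum_monomial_noise s A B :
  \sum_(Y : graph n) edge_weight s Y *
     (edge_monomial B Y * \prod_(e in A) noise s e (Y e)) =
  if A \subset B then \prod_(e in B) pr s e else 0.
Proof.
under [LHS]eq_bigr => Y _ do
  rewrite /edge_monomial [X in _ * (X * _)]big_mkcond /= [X in _ * (_ * X)]big_mkcond /= prod_merge.
rewrite (sum_edge_weight_prod s (fun e y => (if e \in B then y%:R else 1) *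
   (if e \in A then noise s e y else 1))).
case: ifPn => [AB|/subsetPn[e eA eB]].
  rewrite [RHS]big_mkcond; apply: eq_bigr => e _ /=.
  have [eA|eA] := boolP (e \in A); last by case: ifP => _; ring.
  by rewrite (subsetP AB _ eA); rewrite /noise; ring.
rewrite (bigD1 e) //= eA (negPf eB) (_ : _ + _ = 0) ?mul0r // /noise /=.
by field; apply: edge_prob_neq1.
Qed.

Lemma sum_noise_noise s A B :
  \sum_(Y : graph n) edge_weight s Y *
     ((\prod_(e in A) noise s e (Y e)) * \prod_(e in B) noise s e (Y e)) =
  if A == B then \prod_(e in A) (pr s e / (1 - pr s e)) else 0.
Proof.
under [LHS]eq_bigr => Y _ do
  rewrite [X in _ * (X * _)]big_mkcond /= [X in _ * (_ * X)]big_mkcond /= prod_merge.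
rewrite (sum_edge_weight_prod s (fun e y => (if e \in A then noise s e y else 1) *
   (if e \in B then noise s e y else 1))).
have mean0 e : pr s e * noise s e true + (1 - pr s e) * noise s e false = 0.
  by rewrite /noise; field; apply: edge_prob_neq1.
case: eqP => [<-|/eqP neqAB].
  rewrite [RHS]big_mkcond; apply: eq_bigr => e _ /=.
  case: ifP => _; last by ring.
  by rewrite /noise; field; apply: edge_prob_neq1.
have [e eAB] : exists e, (e \in A) != (e \in B).
  apply/existsP; apply: contraR neqAB; rewrite negb_exists => /forallP eqAB.
  by apply/eqP/setP => e; have := eqAB e; rewrite negbK => /eqP.
rewrite (bigD1 e) //= (_ : _ + _ = 0) ?mul0r // -{}[RHS](mean0 e).
by case: (e \in A) (e \in B) eAB => [] [] // _; rewrite !(mul1r, mulr1).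
Qed.

Definition certificate (c : {set edge n} -> R) D s Y : R :=
  \sum_(A : {set edge n} | (#|A| <= D)%N) c A * \prod_(e in A) noise s e (Y e).

Lemma prod_edge_prob s B : \prod_(e in B) pr s e = p ^+ #|B| * eprod B s.
Proof.
by under eq_bigr do rewrite edge_prob_potts; rewrite big_split prodr_const.
Qed.

Lemma certificate_norm c D :
  EE (fun s Y => certificate c D s Y ^+ 2) =
  q%:R^-1 ^+ n * \sum_(A : {set edge n} | (#|A| <= D)%N)
    c A ^+ 2 * \sum_(s : labeling n q) \prod_(e in A) (pr s e / (1 - pr s e)).
Proof.
rewrite expectationE; congr (_ * _).
under [RHS]eq_bigr do rewrite mulr_sumr.
rewrite [RHS]exchange_big /=; apply: eq_bigr => s _.
transitivity (\sum_(Y : graph n) \sum_(A : {set edge n} | (#|A| <= D)%N)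
  \sum_(B : {set edge n} | (#|B| <= D)%N) (c A * c B) * (edge_weight s Y *
     ((\prod_(e in A) noise s e (Y e)) * \prod_(e in B) noise s e (Y e)))).
  apply: eq_bigr => Y _; rewrite expr2 /certificate mulr_suml mulr_sumr.
  apply: eq_bigr => A _; rewrite mulr_sumr mulr_sumr; apply: eq_bigr => B _.
  by ring.
rewrite exchange_big /=; apply: eq_bigr => A AD.
rewrite exchange_big /= (bigD1 A) //= [X in _ + X]big1 ?addr0 => [|B /andP[_ BA]].
  by rewrite -mulr_sumr sum_noise_noise eqxx expr2.
by rewrite -mulr_sumr sum_noise_noise eq_sym (negPf BA) mulr0.
Qed.


Lemma sum_edge_weight s : \sum_(Y : graph n) edge_weight s Y = 1.
Proof.
have := sum_edge_monomial s finset.set0; rewrite big_set0 => <-.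
by apply: eq_bigr => Y _; rewrite /edge_monomial big_set0 mulr1.
Qed.

Let N : R := #|{: {ffun 'I_n -> 'I_q}}|%:R.

Lemma prior_weight : q%:R^-1 ^+ n * N = 1.
Proof.
rewrite /N card_ffun !card_ord natrX exprVn mulVf // expf_neq0 //.
by rewrite pnatr_eq0 -lt0n q_gt0.
Qed.

Section Pair.
Variables u v : 'I_n.
Hypothesis u_neq_v : u != v.
Let W : {set 'I_n} := [set u; v].
Let surp := surplus (ends (@esrc n) (@etgt n)) W.
Let sig := @signal R 'I_n q u v.

Lemma same_communityE s : same_community R u v s = sig s.
Proof.
rewrite /same_community /sig /signal /potts /agree mulrBr mulr1 mulKf //.
by rewrite pnatr_eq0 -lt0n q_gt0.
Qed.

Lemma signal_variance :
  EE (fun s _ => same_community R u v s ^+ 2) = q%:R^-1 * (1 - q%:R^-1).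
Proof.
have q0 : q%:R != 0 :> R by rewrite pnatr_eq0 -lt0n q_gt0.
rewrite expectationE.
under eq_bigr do rewrite -mulr_suml sum_edge_weight mul1r.
rewrite (eq_bigr (fun s : {ffun 'I_n -> 'I_q} =>
  (1 - 2 / q%:R) / q%:R * agree R u v s + q%:R^-1 ^+ 2)).
  rewrite big_split /= -mulr_sumr (sum_agree R q_gt0 u_neq_v) sumr_const.
  rewrite -(mulr_natr (q%:R^-1 ^+ 2)) -/N -mulrDl mulrCA prior_weight mulr1.
  by field.
move=> s _; rewrite /same_community /agree.
by case: (_ == _); rewrite /= ?mulr1n ?mulr0n; field.
Qed.

Lemma signal_variance_ge : (2 * q%:R)^-1 <= q%:R^-1 * (1 - q%:R^-1) :> R.
Proof.
have q2 := qR_ge2; have q0 : 0 < q%:R :> R by rewrite ltr0n q_gt0.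
rewrite invfM mulrC ler_pM2l ?invr_gt0 //.
have : q%:R^-1 <= 2^-1 :> R by rewrite lef_pV2 ?posrE.
by lra.
Qed.

Section Certificate.
Variable c : {set edge n} -> R.
Hypothesis c_eq : forall B, \sum_(A : {set edge n} | A \subset B)
    c A * mixed q (@esrc n) (@etgt n) lam A (B :\: A) =
  signal_mean q (@esrc n) (@etgt n) lam u v B.

(** Only subsets of [B] contribute on the left, each with the same factor
p^|B| g^B; then [sum_coef] applies. *)
Lemma certificate_match D B : (#|B| <= D)%N ->
  EE (fun s Y => edge_monomial B Y * certificate c D s Y) =
  EE (fun s Y => edge_monomial B Y * same_community R u v s).
Proof.
move=> BD; rewrite !expectationE; congr (_ * _).
transitivity (\sum_(s : labeling n q)
    (\sum_(A : {set edge n} | A \subset B) c A) * (p ^+ #|B| * eprod B s)).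
  apply: eq_bigr => s _.
  transitivity (\sum_(A : {set edge n} | (#|A| <= D)%N) \sum_(Y : graph n)
      c A * (edge_weight s Y *
        (edge_monomial B Y * \prod_(e in A) noise s e (Y e)))).
    rewrite exchange_big /=; apply: eq_bigr => Y _.
    rewrite /certificate !mulr_sumr; apply: eq_bigr => A _.
    by ring.
  rewrite mulr_suml [RHS]big_mkcond [LHS]big_mkcond /=; apply: eq_bigr => A _.
  rewrite -mulr_sumr sum_monomial_noise -prod_edge_prob.
  have [AB|nAB] := boolP (A \subset B); last by rewrite mulr0 if_same.
  by rewrite (leq_trans (subset_leq_card AB) BD).
rewrite -mulr_sumr -mulr_sumr mulrCA.
have := sum_coef c_eq B.
rewrite -/eprod => ->.
rewrite mulr_sumr; apply: eq_bigr => s _.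
under [RHS]eq_bigr do rewrite mulrA.
by rewrite -mulr_suml sum_edge_monomial prod_edge_prob same_communityE mulrA.
Qed.

(** The odds p_e / (1 - p_e) exceed p_e by a factor at most
1 / (1 - a / n), and D such factors cost at most 2 because D a / n <= 1/2. *)
Lemma sum_odds_le D A : (#|A| <= D)%N -> D%:R * (a / n%:R) <= 2^-1 ->
  \sum_(s : labeling n q) \prod_(e in A) (pr s e / (1 - pr s e)) <=
  2 * p ^+ #|A| * efun A.
Proof.
move=> AD Da; rewrite mulr_sumr; apply: ler_sum => s _.
rewrite -mulrA -prod_edge_prob; pose x := a / n%:R.
have x1 : x < 1 by rewrite ltr_pdivrMr ?nR_gt0 // mul1r.
have x0 : 0 < x by rewrite divr_gt0 ?nR_gt0 // (lt_le_trans b_gt0).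
have oneA : 1 <= 2 * (1 - x) ^+ #|A|.
  have x01 : 0 <= x <= 1 by rewrite !ltW.
  have := bernoulli_ineq #|A| x01.
  have Ax : #|A|%:R * x <= D%:R * x by rewrite ler_wpM2r ?ler_nat // ltW.
  by move=> /half_le; apply; apply: le_trans Ax Da.
apply: le_trans (_ : \prod_(e in A) (pr s e / (1 - x)) <= _).
  apply: ler_prod => e _; have pr0 := edge_prob_gt0 s e.
  have pr1 := edge_prob_lt1 s e; apply/andP; split.
    by rewrite divr_ge0 ?subr_ge0 // ltW.
  rewrite ler_pM2l // lef_pV2 ?posrE ?subr_gt0 //.
  by rewrite lerB // edge_prob_le.
have xA0 : 0 < (1 - x) ^+ #|A| by rewrite exprn_gt0 // subr_gt0.
rewrite big_split prodr_const /= exprVn ler_pdivrMr // mulrAC ler_peMl //.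
by apply: prodr_ge0 => e _; exact/ltW/edge_prob_gt0.
Qed.

Variable D : nat.
Hypothesis D_gt0 : (0 < D)%N.
Hypothesis D_sparse : D%:R * (a / n%:R) <= 2^-1.
Hypothesis below_KS : avg_degree q a b * lam ^+ 2 <= 1.
Let G : R := (2 * D * q)%:R ^+ 2.
Let X : R := ((2 + 2 * D) ^ 2 * D.+1)%:R.
Let rho : R := G * X / n%:R.
Hypothesis rho_le1 : rho <= 1.

(** The threshold enters here: p lambda^2 <= 1 / n, with no loss per edge. *)
Lemma certificate_term A : (#|A| <= D)%N -> c A != 0 ->
  c A ^+ 2 * (\sum_(s : labeling n q) \prod_(e in A) (pr s e / (1 - pr s e))) <=
  2 / q%:R ^+ 2 * N * (n%:R^-1 ^+ #|A| * G ^+ surp A).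
Proof.
move=> AD cA.
have q0 : 0 < q%:R :> R by rewrite ltr0n q_gt0.
have Z_ge := partition_fun_ge (@esrc n) (@etgt n) q_gt0 snr_lambda_ge0 A.
have Z_gt0 := partition_fun_gt0 (@esrc n) (@etgt n) q_gt0 snr_lambda_ge0 A.
rewrite -/efun -/N in Z_ge Z_gt0.
have N0 : 0 < N := N_gt0 R _ q_gt0.
have cZ := coef_bound q_gt0 (@esrc_neq_etgt n) snr_lambda_ge0 snr_lambda_le1
  u_neq_v c_eq AD cA.
rewrite -/efun -/surp -/N in cZ.
apply: le_trans (ler_wpM2l (sqr_ge0 _) (sum_odds_le AD D_sparse)) _.
have p0 : 0 <= p.
  by rewrite !divr_ge0 ?ler0n // ltW // degree_gt0.
set B := (X in _ <= X) in cZ.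
have B2 : (`|c A| * efun A) ^+ 2 <= B ^+ 2.
  by rewrite ler_pXn2r // nnegrE ?mulr_ge0 ?exprn_ge0 ?invr_ge0 ?ler0n ?snr_lambda_ge0 // ltW.
have cZ2 : c A ^+ 2 * efun A <= B ^+ 2 / N.
  rewrite ler_pdivlMr //; apply: le_trans B2.
  rewrite exprMn real_normK ?num_real //.
  by rewrite -mulrA ler_wpM2l ?sqr_ge0 // expr2 ler_wpM2l // ltW.
apply: le_trans (_ : 2 * p ^+ #|A| * (B ^+ 2 / N) <= _).
  rewrite mulrCA; rewrite ler_wpM2l ?cZ2 // mulr_ge0 ?exprn_ge0 //.
have -> : 2 * p ^+ #|A| * (B ^+ 2 / N) =
    2 / q%:R ^+ 2 * N * ((p * lam ^+ 2) ^+ #|A| * G ^+ surp A).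
  rewrite /B /G [(2 * D * q)%:R]natrM [(p * _) ^+ _]exprMn [lam ^+ 2 ^+ _]exprAC.
  rewrite [(_ * q%:R) ^+ 2 ^+ _]exprAC [(_ * q%:R) ^+ surp A]exprMn.
  by apply: square_regroup; rewrite lt0r_neq0.
rewrite ler_wpM2l ?mulr_ge0 ?invr_ge0 ?exprn_ge0 ?ler0n //.
rewrite ler_wpM2r ?exprn_ge0 ?sqr_ge0 //.
have plam0 : 0 <= p * lam ^+ 2 by rewrite mulr_ge0 ?sqr_ge0.
have plam_le : p * lam ^+ 2 <= n%:R^-1.
  by rewrite /p mulrAC ler_pdivrMr ?nR_gt0 // mulVf ?lt0r_neq0 ?nR_gt0.
by apply: lerXn2r; rewrite // nnegrE // invr_ge0 ler0n.
Qed.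

(** Group the cores by size and surplus: by [card_cores] a group of surplus [r]
contributes at most rho^r, and r >= 1 since a nonempty core is strictly larger
than the empty one. *)
Lemma certificate_norm_le :
  EE (fun s Y => certificate c D s Y ^+ 2) <= 4 * D%:R ^+ 2 * rho / q%:R ^+ 2.
Proof.
have q0 : 0 < q%:R :> R by rewrite ltr0n q_gt0.
have N0 : 0 < N := N_gt0 R _ q_gt0.
pose S := [set A : {set edge n} | (#|A| <= D)%N && (c A != 0)].
have SP A : A \in S -> [/\ core (ends (@esrc n) (@etgt n)) W A,
    (#|A| < D.+1)%N, (surp A < D.+1)%N & (0 < surp A)%N].
  rewrite inE => /andP[AD cA].
  have coreA := coef_core q_gt0 (@esrc_neq_etgt n) snr_lambda_ge0 u_neq_v c_eq cA.
  split=> //.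
    rewrite ltnS (leq_trans _ AD) // leq_subLR addnC leq_add2r.
    exact/subset_leq_card/sub_verts.
  rewrite -{1}(surplus0 (ends (@esrc n) (@etgt n)) W).
  apply: core_surplus_lt => //.
  - exact/card_ends/esrc_neq_etgt.
  - exact: core0.
  rewrite properE sub0set subset0 -/(_ != _); apply: contraNneq cA => ->.
  by rewrite (coef_set0 q_gt0 snr_lambda_ge0 u_neq_v c_eq).
have rho0 : 0 <= rho by rewrite !mulr_ge0 ?sqr_ge0 ?invr_ge0 ?ler0n.
have count m r : (m < D.+1)%N -> (0 < r)%N ->
    \sum_(A in [set A in S | (#|A| == m) && (surp A == r)])
       n%:R^-1 ^+ #|A| * G ^+ surp A <= rho.
  move=> mD r0; rewrite (eq_bigr (fun=> n%:R^-1 ^+ m * G ^+ r)); last first.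
    by move=> A; rewrite inE => /and3P[_ /eqP-> /eqP->].
  rewrite sumr_const -(mulr_natr (_ * _)); set k := #|_|.
  have := @card_cores _ _ _ (card_ends (@esrc_neq_etgt n)) (@edge_ends_inj n) W D m r
    [set A in S | (#|A| == m) && (surp A == r)] mD.
  rewrite -/k cards2 u_neq_v card_ord => cnt.
  have {cnt} : k%:R * n%:R ^+ r <= n%:R ^+ m * X ^+ r.
    rewrite /X -!natrX -!natrM ler_nat; apply: cnt => A.
    by rewrite inE => /andP[/SP[? _ _ _] /andP[/eqP-> /eqP]].
  have n0 := nR_gt0; have G0 : 0 <= G := sqr_ge0 _.
  move=> cnt; apply: le_trans (_ : rho ^+ r <= _); last first.
    by rewrite -{2}[rho]expr1 ler_wiXn2l.
  have -> : rho ^+ r = G ^+ r * (X ^+ r / n%:R ^+ r).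
    by rewrite /rho !exprMn exprVn mulrA.
  rewrite mulrAC mulrC ler_wpM2l ?exprn_ge0 // ler_pdivlMr ?exprn_gt0 //.
  by rewrite exprVn -mulrA mulrC ler_pdivrMr ?exprn_gt0 // [leRHS]mulrC.
have sumS : \sum_(A in S) n%:R^-1 ^+ #|A| * G ^+ surp A <= 2 * D%:R ^+ 2 * rho.
  pose f A : 'I_D.+1 * 'I_D.+1 := (inord #|A|, inord (surp A)).
  rewrite (partition_big f (fun k => 0 < k.2)%N); last first.
    by move=> A /SP[_ _ sD s0]; rewrite /f /= inordK.
  apply: le_trans (_ : \sum_(k : 'I_D.+1 * 'I_D.+1 | (0 < k.2)%N) rho <= _).
    apply: ler_sum => -[m r] /= r0; apply: le_trans (count m r (ltn_ord m) r0).
    rewrite le_eqVlt; apply/orP; left; apply/eqP/eq_bigl => A; rewrite inE.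
    case AS: (A \in S) => //=; have [_ AD sD _] := SP A AS.
    by rewrite /f xpair_eqE -!val_eqE /= !inordK.
  rewrite sumr_const -[_ *+ _]mulr_natl ler_wpM2r //.
  have -> : #|[pred k : 'I_D.+1 * 'I_D.+1 | (0 < k.2)%N]| = (D.+1 * D)%N.
    rewrite (eq_card (B := [predX xpredT & [pred r : 'I_D.+1 | r != ord0]])).
      by rewrite cardX card_ord cardC1 card_ord.
    by move=> [m r]; rewrite !inE /= -lt0n.
  rewrite -natrX -natrM ler_nat; nia.
rewrite certificate_norm.
apply: le_trans (_ : q%:R^-1 ^+ n * \sum_(A in S)
   2 / q%:R ^+ 2 * N * (n%:R^-1 ^+ #|A| * G ^+ surp A) <= _).
  rewrite ler_wpM2l ?exprn_ge0 ?invr_ge0 ?ler0n //.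
  rewrite (bigID (fun A => c A != 0)) /= [X in _ + X]big1 ?addr0; last first.
    by move=> A /andP[_ /negPn/eqP->]; rewrite expr0n mul0r.
  rewrite (eq_bigl (mem S)); last by move=> A; rewrite !inE.
  by apply: ler_sum => A; rewrite !inE => /andP[AD cA]; apply: certificate_term.
rewrite -mulr_sumr mulrA [q%:R^-1 ^+ n * _]mulrCA prior_weight mulr1.
rewrite [leRHS](_ : _ = 2 / q%:R ^+ 2 * (2 * D%:R ^+ 2 * rho)); last by ring.
by rewrite ler_wpM2l // divr_ge0 // sqr_ge0.
Qed.

End Certificate.

(** Since Y_e is 0 or 1, positive powers of Y_e do not differ from Y_e. *)
Lemma edge_poly_evalE (f : edge_poly R n) Y :
  edge_poly_eval f Y = \sum_(m <- mpoly.msupp f) mpoly.mcoeff m f *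
    edge_monomial [set e | mpoly.fun_of_multinom m (enum_rank e) != 0%N] Y.
Proof.
rewrite /edge_poly_eval mpoly.mevalE; apply: eq_bigr => m _; congr (_ * _).
rewrite /edge_monomial [RHS]big_mkcond /=.
rewrite (reindex (@enum_rank (edge n))) /=; last exact/onW_bij/enum_rank_bij.
apply: eq_bigr => e _; rewrite enum_rankK inE.
case: (mpoly.fun_of_multinom m _) => [|k] /=; first by rewrite expr0.
by case: (Y e); rewrite ?expr1n // expr0n.
Qed.

Lemma card_multinom_support (f : edge_poly R n) (m : mpoly.multinom #|edge n|) D :
  (edge_poly_deg f <= D)%N -> m \in mpoly.msupp f ->
  (#|[set e : edge n | mpoly.fun_of_multinom m (enum_rank e) != 0%N]| <= D)%N.
Proof.
move=> fD /mpoly.msize_mdeg_lt mf.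
apply: leq_trans (_ : mpoly.mdeg m <= _)%N; last first.
  by rewrite (leq_trans _ fD) // /edge_poly_deg; case: mpoly.mmeasure mf.
rewrite mpoly.mdegE -sum1_card.
rewrite [leqRHS](reindex (@enum_rank (edge n))) /=; last exact/onW_bij/enum_rank_bij.
rewrite big_mkcond /=; apply: leq_sum => e _; rewrite inE.
by case: (mpoly.fun_of_multinom m _).
Qed.

Lemma low_degree_correlation (f : edge_poly R n) D :
    (0 < D)%N -> D%:R * (a / n%:R) <= 2^-1 ->
    avg_degree q a b * lam ^+ 2 <= 1 ->
    (edge_poly_deg f <= D)%N ->
  let rho := (2 * D * q)%:R ^+ 2 * ((2 + 2 * D) ^ 2 * D.+1)%:R / n%:R in
  rho <= 1 ->
  EE (fun s Y => edge_poly_eval f Y * same_community R u v s) ^+ 2 <=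
    8 * D%:R ^+ 2 * rho * (EE (fun _ Y => edge_poly_eval f Y ^+ 2) *
                           EE (fun s _ => same_community R u v s ^+ 2)).
Proof.
move=> D0 Da KS fD rho rho1.
have [c c_eq] := exists_coefficients (@esrc n) (@etgt n) u v q_gt0 snr_lambda_ge0.
have q0 : 0 < q%:R :> R by rewrite ltr0n q_gt0.
have rho0 : 0 <= rho by rewrite !mulr_ge0 ?sqr_ge0 ?invr_ge0 ?ler0n.
have -> : EE (fun s Y => edge_poly_eval f Y * same_community R u v s) =
          EE (fun s Y => edge_poly_eval f Y * certificate c D s Y).
  rewrite (eq_expectation (G := fun s Y => \sum_(m <- mpoly.msupp f) mpoly.mcoeff m f *
    (edge_monomial [set e | mpoly.fun_of_multinom m (enum_rank e) != 0%N] Y *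
     same_community R u v s))); last first.
    move=> s Y; rewrite edge_poly_evalE mulr_suml.
    by apply: eq_bigr => m _; rewrite mulrA.
  rewrite [RHS](eq_expectation (G := fun s Y => \sum_(m <- mpoly.msupp f) mpoly.mcoeff m f *
    (edge_monomial [set e | mpoly.fun_of_multinom m (enum_rank e) != 0%N] Y *
     certificate c D s Y))); last first.
    move=> s Y; rewrite edge_poly_evalE mulr_suml.
    by apply: eq_bigr => m _; rewrite mulrA.
  rewrite (expectation_sum _ _ _
    (fun m s Y => edge_monomial [set e | mpoly.fun_of_multinom m (enum_rank e) != 0%N] Y *
       same_community R u v s)).
  rewrite (expectation_sum _ _ _
    (fun m s Y => edge_monomial [set e | mpoly.fun_of_multinom m (enum_rank e) != 0%N] Y *
       certificate c D s Y)).
  rewrite big_seq [RHS]big_seq; apply: eq_bigr => m mf; congr (_ * _).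
  by rewrite (certificate_match c_eq) // (card_multinom_support fD).
apply: le_trans (expectation_cauchy_schwarz _ _) _.
rewrite mulrCA; apply: ler_wpM2l.
  rewrite expectationE mulr_ge0 ?exprn_ge0 ?invr_ge0 ?ler0n //.
  by do 2! (apply: sumr_ge0 => ? _); rewrite mulr_ge0 ?sqr_ge0 ?edge_weight_ge0.
apply: le_trans (certificate_norm_le c_eq D0 Da KS rho1) _.
rewrite signal_variance.
apply: le_trans (_ : 8 * D%:R ^+ 2 * rho * (2 * q%:R)^-1 <= _); last first.
  by rewrite ler_wpM2l ?signal_variance_ge // !mulr_ge0 ?sqr_ge0.
rewrite -/rho [leRHS](_ : _ = 4 * D%:R ^+ 2 * rho / q%:R); last first.
  by field; rewrite lt0r_neq0.
rewrite ler_wpM2l ?mulr_ge0 ?sqr_ge0 // lef_pV2 ?posrE ?exprn_gt0 //.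
have := qR_ge2; nra.
Qed.

End Pair.
End BlockModel.

(** * Asymptotics *)

Local Open Scope classical_set_scope.

Lemma powR_large (R : realType) (x M : R) : 0 < x ->
  \forall n \near \oo, M <= n%:R `^ x.
Proof.
move=> x0; have x_neq0 : x != 0 by rewrite gt_eqF.
have [M0|M0] := leP M 0.
  by near=> n; apply: le_trans M0 (powR_ge0 _ _).
have <- : (M `^ x^-1) `^ x = M by rewrite -powRrM mulVf // powRr1 // ltW.
near=> n; apply: (ge0_ler_powR (ltW x0)); rewrite ?nnegrE ?powR_ge0 ?ler0n //.
by near: n; apply: nbhs_infty_ger.
Unshelve. all: by end_near. Qed.

Lemma near_Theta_bounds (R : realType) (f g : nat -> R) :
  (forall n, 0 < f n) -> (forall n, 0 < g n) -> f =Theta_\oo g ->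
  exists k1 k2 : R, [/\ 0 < k1, 0 < k2 &
    \forall n \near \oo, k1 * g n <= f n <= k2 * g n].
Proof.
move=> f0 g0; rewrite eqThetaE qualifE => /asboolP[[k1 k2] /= /andP[k10 k20] H].
exists k1, k2; split=> //; apply: filterS H => n [].
by rewrite !gtr0_norm // => -> ->.
Qed.

Lemma cubic_le k : (0 < k)%N ->
  ((2 + 2 * k) ^ 2 * k.+1 <= (4 * k) ^ 2 * (2 * k))%N.
Proof. by move=> k0; apply: leq_mul; rewrite ?leq_sqr; lia. Qed.

(** The power 7 of the degree bound [x] collects 2 from the numbers of sizes and
surpluses, 2 from [coef_bound] and 3 from [card_cores]. *)
Lemma Corr_le (R : realType) (n q : nat) (a b : R) (u v : 'I_n) (x t : R)
    (D := Num.truncn x) :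
    (1 < q)%N -> 0 < b -> b <= a -> a < n%:R -> u != v -> 1 <= x -> 0 <= t ->
    avg_degree q a b * snr_lambda q a b ^+ 2 <= 1 ->
    x * (a / n%:R) <= 2^-1 ->
    2 ^+ 10 * x ^+ 7 * q%:R ^+ 2 / n%:R <= t ^+ 2 -> t <= 1 ->
  (Corr q a b u v x <= t%:E)%E.
Proof.
move=> q1 b0 ba an uv x1 t0 KS xa tau t1.
have n0 : (0 < n)%N by apply: leq_ltn_trans (leq0n u) (ltn_ord u).
have nR0 : 0 < n%:R :> R by rewrite ltr0n.
have x0 : 0 <= x by lra.
have /andP[Dx _] := truncn_itv x0; rewrite -/D in Dx.
have D0 : (0 < D)%N by rewrite truncn_gt0.
have D1 : 1 <= D%:R :> R by rewrite ler1n.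
have Da : D%:R * (a / n%:R) <= 2^-1.
  apply: le_trans xa; rewrite ler_wpM2r // divr_ge0 ?ler0n //.
  exact: le_trans (ltW b0) ba.
pose rho : R := (2 * D * q)%:R ^+ 2 * ((2 + 2 * D) ^ 2 * D.+1)%:R / n%:R.
have rho_tau : 8 * D%:R ^+ 2 * rho <= t ^+ 2.
  apply: le_trans tau; rewrite /rho mulrA ler_pM2r ?invr_gt0 //.
  apply: (@le_trans _ _ (2 ^+ 10 * D%:R ^+ 7 * q%:R ^+ 2)); last first.
    by rewrite ler_wpM2r ?sqr_ge0 // ler_wpM2l // lerXn2r ?nnegrE ?ler0n.
  apply: (@le_trans _ _ (8 * D%:R ^+ 2 *
      ((2 * D * q)%:R ^+ 2 * ((4 * D) ^ 2 * (2 * D))%:R))).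
    apply: ler_wpM2l; first by rewrite mulr_ge0 ?sqr_ge0.
    apply: ler_wpM2l; first exact: sqr_ge0.
    by rewrite ler_nat; apply: cubic_le.
  by rewrite !natrM le_eqVlt; apply/orP; left; apply/eqP; ring.
have rho0 : 0 <= rho by rewrite !mulr_ge0 ?sqr_ge0 ?invr_ge0 ?ler0n.
have rho1 : rho <= 1.
  apply: le_trans (_ : t ^+ 2 <= 1); last by rewrite expr_le1.
  apply: le_trans rho_tau; rewrite -[leLHS]mul1r ler_wpM2r //.
  have : 1 <= D%:R ^+ 2 :> R by rewrite exprn_ege1.
  by lra.
apply: ge_ereal_sup => _ [f [fD f0] <-]; rewrite lee_fin.
have fD' : (edge_poly_deg f <= D)%N by rewrite truncn_ge_nat.
have := low_degree_correlation n0 q1 b0 ba an uv D0 Da KS fD' rho1.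
set Efx := sbm_expectation _ _ _; set Ef2 := sbm_expectation _ _ _.
set Ex2 := sbm_expectation _ _ _; rewrite -/rho => corr.
have Ef2_gt0 : 0 < Ef2.
  rewrite lt_def f0 /=; apply: sumr_ge0 => s _; apply: sumr_ge0 => Y _.
  rewrite mulr_ge0 ?sqr_ge0 // mulr_ge0 ?exprn_ge0 ?invr_ge0 ?ler0n //.
  exact: edge_weight_ge0.
have Ex2_gt0 : 0 < Ex2.
  rewrite /Ex2 (signal_variance a b q1 uv).
  have q1R : 1 < q%:R :> R by rewrite ltr1n.
  have q0R : 0 < q%:R :> R by lra.
  by rewrite mulr_gt0 ?invr_gt0 // subr_gt0 invf_lt1.
rewrite ler_pdivrMr ?sqrtr_gt0 ?mulr_gt0 //.
have P0 : 0 <= Ef2 * Ex2 by rewrite mulr_ge0 // ltW.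
apply: (@le_trans _ _ (Num.sqrt (t ^+ 2 * (Ef2 * Ex2)))).
  apply: le_trans (ler_norm _) _; rewrite -sqrtr_sqr ler_wsqrtr //.
  by apply: le_trans corr _; rewrite ler_wpM2r.
by rewrite sqrtrM ?sqr_ge0 // sqrtr_sqr ger0_norm.
Qed.

Theorem theorem1p4 (R : realType) (q : nat -> nat) (a b : nat -> R)
  (q_ge2 : forall n : nat, (2 <= q n)%N)
  (a_gt0 : forall n : nat, 0 < a n)
  (b_gt0 : forall n : nat, 0 < b n)
  (q_omega1 : ((q n)%:R : R) @[n --> \oo] --> +oo)
  (a_Theta_q : a =Theta_\oo (fun n : nat => (q n)%:R : R))
  (b_Theta_1 : b =Theta_\oo (fun _ : nat => 1 : R))
  (q_small : exists2 eps : R, 0 < eps &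
     \forall n \near \oo, ((q n)%:R : R) <= n%:R `^ (1 / 2 - eps))
  (below_KS : \forall n \near \oo,
     avg_degree (q n) (a n) (b n) * snr_lambda (q n) (a n) (b n) ^+ 2 <= 1) :
  exists c c' : R, [/\ 0 < c, 0 < c' &
    \forall n \near \oo, forall u v : 'I_n,
      u = 0%N :> nat -> v = 1%N :> nat ->
      (Corr (q n) (a n) (b n) u v (n%:R `^ c) <= (n%:R `^ (- c'))%:E)%E].
Proof.
(* With c = eps / 14 the factor n^(7 c) uses up n^(eps / 2), and another
   n^(eps / 2) absorbs the constant 2^10; out of q^2 / n <= n^(- 2 eps) there
   remains n^(- eps), the square of n^(- eps / 2). *)
case: q_small => eps eps0 q_small.
have qR_gt0 n : 0 < (q n)%:R :> R by rewrite ltr0n (leq_trans _ (q_ge2 n)).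
have [k1 [k2 [k10 k20 a_bounds]]] := near_Theta_bounds a_gt0 qR_gt0 a_Theta_q.
have [k0 [k3 [_ _ b_bounds]]] := near_Theta_bounds b_gt0 (fun=> ltr01) b_Theta_1.
have q_large : \forall n \near \oo, k3 / k1 <= (q n)%:R by move/cvgryPge: q_omega1; apply.
have c0 : 0 < eps / 14 by rewrite divr_gt0.
exists (eps / 14), (eps / 2); split; rewrite ?divr_gt0 //.
near=> n => u v u0 v1.
have n0 : (0 < n)%N by apply: leq_ltn_trans (leq0n u) (ltn_ord u).
have n1 : 1 <= n%:R :> R by rewrite ler1n.
have nR0 : 0 < n%:R :> R by rewrite ltr0n.
have nn : n%:R != 0 :> R by rewrite gt_eqF.
have /andP[a_ge a_le] : k1 * (q n)%:R <= a n <= k2 * (q n)%:R by near: n.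
have b_le : b n <= k3.
  suff /andP[_] : k0 * 1 <= b n <= k3 * 1 by rewrite mulr1.
  by near: n.
have ba : b n <= a n.
  apply: le_trans b_le _; apply: le_trans a_ge; rewrite mulrC -ler_pdivrMr //.
  by near: n.
have q_le : (q n)%:R <= n%:R `^ (1 / 2 - eps) by near: n.
have half_large : 2 * k2 <= n%:R `^ (1 / 2) by near: n; apply: powR_large.
have eps_large : 2 ^+ 10 <= n%:R `^ (eps / 2).
  by near: n; apply: powR_large; rewrite divr_gt0.
have x1 : 1 <= n%:R `^ (eps / 14).
  by rewrite -[leLHS](powRr0 n%:R) ler_powR // ltW.
have xa : n%:R `^ (eps / 14) * (a n / n%:R) <= 2^-1.
  have : n%:R `^ (eps / 14) * (a n / n%:R) <= k2 * n%:R `^ (- (1 / 2)).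
    apply: (@le_trans _ _ (n%:R `^ (eps / 14) * (k2 * n%:R `^ (1 / 2 - eps) / n%:R))).
      apply: ler_wpM2l; first exact: powR_ge0.
      rewrite ler_pM2r ?invr_gt0 //; apply: le_trans a_le _.
      by rewrite ler_wpM2l // ltW.
    rewrite [leLHS](_ : _ = k2 * n%:R `^ (eps / 14 + (1 / 2 - eps) - 1)).
      by rewrite ler_pM2l // ler_powR //; lra.
    by rewrite [in RHS]powRB ?nn ?implybT // [in RHS]powRD ?nn ?implybT // powRr1 ?ltW //; ring.
  move/le_trans; apply; rewrite powRN ler_pdivrMr ?powR_gt0 //.
  by rewrite ler_pdivlMl // in half_large *.
apply: Corr_le => //.
- have : a n / n%:R <= 2^-1.
    apply: le_trans xa; rewrite ler_peMl // divr_ge0 ?ltW //.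
  by rewrite ler_pdivrMr // => /le_lt_trans; apply; move: nR0; lra.
- by rewrite -val_eqE /= u0 v1.
- by near: n.
- have x7 : (n%:R `^ (eps / 14)) ^+ 7 = n%:R `^ (eps / 2) :> R.
    by rewrite -powR_mulrn ?powR_ge0 // -powRrM; congr (_ `^ _); field.
  have t2 : (n%:R `^ (- (eps / 2))) ^+ 2 = n%:R `^ (- eps) :> R.
    by rewrite -powR_mulrn ?powR_ge0 // -powRrM; congr (_ `^ _); field.
  have q2 : (q n)%:R ^+ 2 <= n%:R `^ (1 - 2 * eps).
    rewrite (_ : 1 - 2 * eps = (1 / 2 - eps) * 2%:R); last by field.
    by rewrite powRrM powR_mulrn ?powR_ge0 // lerXn2r ?nnegrE ?powR_ge0 ?ler0n.
  rewrite x7 t2.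
  apply: (@le_trans _ _ (n%:R `^ (eps / 2) * n%:R `^ (eps / 2) *
     n%:R `^ (1 - 2 * eps) / n%:R)).
    rewrite ler_pM2r ?invr_gt0 //; apply: ler_pM q2.
    + by rewrite mulr_ge0 ?powR_ge0 // exprn_ge0.
    + exact: sqr_ge0.
    by rewrite ler_wpM2r ?powR_ge0.
  rewrite -!powRD ?nn ?implybT // ler_pdivrMr // -[X in _ <= _ * X](powRr1 (ltW nR0)).
  by rewrite -powRD ?nn ?implybT // ler_powR //; lra.
- by rewrite powRN invf_le1 ?powR_gt0 // -[leLHS](powRr0 n%:R) ler_powR // divr_ge0 // ltW.
Unshelve. all: by end_near. Qed.
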